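(* Let $\alpha>0$, $(a,b)\in\mathbb{R}^2$ with $a<b$, and let $f\in L^1([a,b];\mathbb{R})$ be such that $J_b^\alpha f$ has an absolutely continuous representative. Then $$S_b^\alpha\left(\mathcal{D}_b^\alpha f\right)(x)=-f(x)+\left(J_b^\alpha f\right)(b)\,\mathcal{S}\left(\frac{b-x}{\alpha}\right),\quad \text{for a.e. } x\in[a,b].$$
   Context: Let $E_1(x)=\int_x^\infty \frac{e^{-t}}{t}\,dt$ for $x>0$ and $\mathcal{S}(t)=e^{-t}\int_0^\infty \frac{t^{s-1}}{\Gamma(s)}\,ds$ for $t>0$, where $\Gamma$ is the Gamma function. For $\alpha>0$ and $f\in L^1([a,b];\mathbb{R})$, define for a.e. $x\in[a,b]$ $$(J_b^\alpha f)(x)=\frac{1}{\alpha}\int_x^b E_1\left(\frac{t-x}{\alpha}\right)f(t)\,dt,\qquad (S_b^\alpha f)(x)=\int_x^b \mathcal{S}\left(\frac{t-x}{\alpha}\right)f(t)\,dt.$$ A function in $L^1([a,b];\mathbb{R})$ has an absolutely continuous representative if it coincides a.e. on $[a,b]$ with an absolutely continuous function on $[a,b]$; it is then identified with that function, so that $(J_b^\alpha f)(b)$ denotes the value at $b$ of the absolutely continuous representative of $J_b^\alpha f$. If $J_b^\alpha f$ has an absolutely continuous representative, the right-sided fractional derivative of order $\alpha$ of $f$ is $(\mathcal{D}_b^\alpha f)(x)=\frac{d}{dx}(J_b^\alpha f)(x)$ for a.e. $x\in[a,b]$. *)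

(* Defs.v *)
From HB Require Import structures.
From mathcomp Require Import all_boot all_order all_algebra.
From mathcomp Require Import all_classical all_reals all_analysis.

Set Implicit Arguments.
Unset Strict Implicit.
Unset Printing Implicit Defensive.

Import Order.TTheory GRing.Theory Num.Theory.
Import numFieldNormedType.Exports.

Local Open Scope classical_set_scope.
Local Open Scope ring_scope.

Definition Gamma (R : realType) (s : R) : R :=
  \int[lebesgue_measure]_(t in `]0, +oo[) (t `^ (s - 1) * expR (- t)).

Definition E1 (R : realType) (x : R) : R :=
  \int[lebesgue_measure]_(t in `[x, +oo[) (expR (- t) / t).

Definition calS (R : realType) (t : R) : R :=
  expR (- t) * \int[lebesgue_measure]_(s in `]0, +oo[) (t `^ (s - 1) / Gamma s).

(* [E1] and [calS] are meaningful at positive arguments only: below, they are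
   evaluated at 0 just for [t = x], which does not affect the integrals. Where
   an integrand is not integrable (a null set of [x] when [f] is integrable),
   [Rintegral] returns a default value. *)
Definition Jint (R : realType) (alpha b : R) (f : R -> R) (x : R) : R :=
  alpha^-1 *
  \int[lebesgue_measure]_(t in `[x, b]) (E1 ((t - x) / alpha) * f t).

Definition Sint (R : realType) (alpha b : R) (f : R -> R) (x : R) : R :=
  \int[lebesgue_measure]_(t in `[x, b]) (calS ((t - x) / alpha) * f t).

Definition abs_continuous (R : realType) (a b : R) (F : R -> R) : Prop :=
  forall e : R, 0 < e -> exists2 d : R, 0 < d &
    forall (n : nat) (u v : 'I_n -> R),
      (forall i, [/\ a <= u i, u i < v i & v i <= b]) ->
      trivIset setT (fun i => `]u i, v i[%classic) ->
      \sum_(i < n) (v i - u i) < d ->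
      \sum_(i < n) `|F (v i) - F (u i)| < e.

Definition is_ac_repr (R : realType) (a b : R) (g G : R -> R) : Prop :=
  abs_continuous a b G /\
  {ae (@lebesgue_measure R), forall x, x \in `[a, b] -> g x = G x}.

Definition has_ac_repr (R : realType) (a b : R) (g : R -> R) : Prop :=
  exists G : R -> R, is_ac_repr a b g G.

(* When [a < b], two representatives of [g] are continuous on [[a, b]] and
   equal almost everywhere there, hence equal on [[a, b]]: the values on
   [[a, b]] and the derivative on the open interval do not depend on the
   choice. *)
Definition ac_repr (R : realType) (a b : R) (g : R -> R) : R -> R :=
  xget (fun=> 0) [set G | is_ac_repr a b g G].

(* [derive1] is total; an absolutely continuous function is derivable at almost
   every point of [[a, b]]. *)
Definition Dfrac (R : realType) (alpha a b : R) (f : R -> R) : R -> R :=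
  derive1 (ac_repr a b (Jint alpha b f)).

(* Main.v *)
(** The kernels E1 and S form a Sonine pair: their convolution is 1 on the positive
    half-line.  Indeed S(t) is the integral over s > 0 of the Gamma densities
    g_s(t) = t^(s-1) e^(-t) / Gamma(s), which form a convolution semigroup, so
    S * g_h is the integral of g_s over s > h.  Writing F_h for the tail of g_h, it
    follows that (S * F_h)(T) is the integral over 0 < s < h of P(X_s <= T), where
    X_s has density g_s.  Dividing by h and letting h tend to 0, the right-hand
    side tends to 1 and F_h / h tends to E1.

    Let G be the absolutely continuous representative of J f and g its derivative.
    Convolving G with S and using the Sonine identity on one side and
    G(t) = G(b) - int_t^b g on the other, Fubini's theorem yields, for all x,
    int_x^b f = int_x^b (G(b) S((b - v) / alpha) - (S_b g)(v)) dv,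
    and Lebesgue's differentiation theorem concludes.

    That G is the integral of its derivative is obtained from the Radon-Nikodym
    theorem applied to the Lebesgue-Stieltjes measures of the positive variations
    of G and - G.  These are dominated by the Lebesgue measure since the positive
    variation of x |-> G x - k x on [a, b] tends to 0 as k tends to infinity. *)

Require Import Defs.
From HB Require Import structures.
From mathcomp Require Import all_boot all_order all_algebra.
From mathcomp Require Import all_classical all_reals all_analysis.
From mathcomp Require Import measurable_realfun ring lra.

Set Implicit Arguments.
Unset Strict Implicit.
Unset Printing Implicit Defensive.
Set SsrOldRewriteGoalsOrder.

Import Order.TTheory GRing.Theory Num.Theory.
Import numFieldNormedType.Exports.

Local Open Scope classical_set_scope.
Local Open Scope ring_scope.

(** * Absolutely continuous functions are integrals *)

(** The passage from F_h / h to E1 is the delicate limit, since E1 is unbounded at 0; it is replaced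
    by two inequalities. Convexity gives y^(h-1) <= 1/y + h for all y > 0. The reverse comparison
    1/y <= d^(-h) y^(h-1) holds only for y >= d, so E1 is first cut at d and d is sent to 0 by
    monotone convergence. The constants come from total masses: comparing them turns the Beta
    integral into a quotient of Gamma values, and 1/(1+h) <= h Gamma(h) <= 1+h converts 1/Gamma(h)
    into h. The formula for S * F_h cancels a common term of two expansions of S * 1, which must
    therefore be finite; the bound P(X_s < T) <= e^T 2^(-s) provides this. Kernels are nonnegative
    and extended-valued so that Tonelli's theorem applies freely. Real values enter with the signed
    functions f and g, where [fine] could hide an infinite value: hence the care taken with null
    sets. *)

Section AbsoluteContinuity.
Context {R : realType}.
Implicit Types (a b x y : R) (F G : R -> R).

(** A selection of disjoint intervals is again such a family, renumbered by [enum_val]. It serves to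
    keep only the cells where F grows fast, as only these have small total length. *)
Lemma abs_continuous_sum a b F e : abs_continuous a b F -> 0 < e ->
  exists2 d : R, 0 < d & forall (n : nat) (u v : 'I_n -> R) (P : pred 'I_n),
    (forall i, [/\ a <= u i, u i < v i & v i <= b]) ->
    trivIset setT (fun i => `]u i, v i[%classic) ->
    \sum_(i < n | P i) (v i - u i) < d ->
    \sum_(i < n | P i) `|F (v i) - F (u i)| < e.
Proof.
move=> acF /acF[d d0 dP]; exists d => // n u v P uv tI.
have big_sub (h : 'I_n -> R) :
    \sum_(i < n | P i) h i = \sum_(j < #|P|) h (enum_val j).
  by rewrite -(big_enum_val (A := P)).
rewrite !big_sub; apply: (dP _ (u \o enum_val) (v \o enum_val)) => [i|] /=.
  exact: uv.
move=> i j _ _ ij; apply: enum_val_inj; exact: tI.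
Qed.

Lemma itv_partition_nth_lt a b s i j : itv_partition a b s ->
  (i < j <= size s)%N -> nth b (a :: s) i < nth b (a :: s) j.
Proof.
move=> [ps _] /andP[ij js].
have := @sorted_ltn_nth _ <%R lt_trans b (a :: s) ps i j.
by rewrite !inE/= !ltnS; apply => //; exact: leq_trans (ltnW ij) js.
Qed.

Lemma itv_partition_disjoint a b s : itv_partition a b s ->
  trivIset setT (fun i : 'I_(size s) =>
    `]nth b (a :: s) i, nth b (a :: s) i.+1[%classic).
Proof.
move=> ps i j _ _ [z [/=]]; rewrite !in_itv/= => /andP[iz zi] /andP[jz zj].
apply/val_inj; have [ij|ji|//] := ltngtP (val i) (val j).
- have : nth b (a :: s) i.+1 <= nth b (a :: s) j.
    move: ij; rewrite leq_eqVlt => /predU1P[->//|ij].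
    by apply/ltW/itv_partition_nth_lt => //; rewrite ij ltnW.
  by move=> h; have := lt_trans zi (le_lt_trans h jz); rewrite ltxx.
- have : nth b (a :: s) j.+1 <= nth b (a :: s) i.
    move: ji; rewrite leq_eqVlt => /predU1P[->//|ji].
    by apply/ltW/itv_partition_nth_lt => //; rewrite ji ltnW.
  by move=> h; have := lt_trans zj (le_lt_trans h iz); rewrite ltxx.
Qed.

Lemma abs_continuous_partition a b F e : abs_continuous a b F -> 0 < e ->
  exists2 d : R, 0 < d & forall x y s (P : pred 'I_(size s)),
    a <= x -> y <= b -> itv_partition x y s ->
    let X := nth y (x :: s) in
    \sum_(i < size s | P i) (X i.+1 - X i) < d ->
    \sum_(i < size s | P i) `|F (X i.+1) - F (X i)| < e.
Proof.
move=> acF /(abs_continuous_sum acF)[d d0 dP].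
exists d => // x y s P ax yb ps X.
apply: (dP _ (fun i => X i) (fun i => X i.+1)) => [i|].
  split; first by apply: (le_trans ax); apply: itv_partition_nth_ge ps; rewrite ltnS ltnW.
    by apply: itv_partition_nth_lt => //; rewrite ltnSn ltn_ord.
  by apply: le_trans yb; apply: itv_partition_nth_le ps; rewrite ltnS.
exact: itv_partition_disjoint.
Qed.

Lemma sum_itv_partition x y s G : itv_partition x y s ->
  let X := nth y (x :: s) in
  \sum_(i < size s) (G (X i.+1) - G (X i)) = G y - G x.
Proof.
move=> ps X; rewrite -(big_mkord xpredT (fun i => G (X i.+1) - G (X i))).
by rewrite telescope_sumr// /X (itv_partition_nth_size _ ps).
Qed.

Lemma abs_continuousB_lin a b F k :
  abs_continuous a b F -> abs_continuous a b (fun x => F x - k * x).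
Proof.
move=> acF e e0.
have [d d0 dP] := acF _ (divr_gt0 e0 (ltr0Sn _ 1)).
have k0 : 0 < `|k| + 1 by rewrite ltr_wpDl.
exists (Num.min d (e / 2 / (`|k| + 1))).
  by rewrite lt_min d0 !divr_gt0.
move=> n u v uv tI; rewrite lt_min => /andP[/(dP n u v uv tI) h1].
rewrite ltr_pdivlMr// => h2; rewrite [ltRHS](splitr e).
apply: (@le_lt_trans _ _ (\sum_(i < n) (`|F (v i) - F (u i)| +
    (v i - u i) * (`|k| + 1)))).
  apply: ler_sum => i _.
  have [_ /ltW uvi _] := uv i.
  have -> : F (v i) - k * v i - (F (u i) - k * u i) =
            (F (v i) - F (u i)) - k * (v i - u i) by ring.
  apply: (le_trans (ler_normB _ _)); rewrite lerD2l normrM.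
  rewrite [`|v i - _|]ger0_norm ?subr_ge0// mulrC ler_wpM2l ?subr_ge0//.
  by rewrite lerDl.
by rewrite big_split/= -mulr_suml ltrD.
Qed.

Lemma abs_continuousN a b F :
  abs_continuous a b F -> abs_continuous a b (\- F).
Proof.
move=> acF e /acF[d d0 dP]; exists d => // n u v uv tI /(dP n u v uv tI).
by under eq_bigr do rewrite distrC; under [X in _ -> X < _]eq_bigr do
  rewrite -opprD normrN distrC.
Qed.

(** For e = 1, absolute continuity bounds by 1 the variation on any interval shorter than [d].
    Finitely many such intervals make up [a, b], and total variation is additive. *)
Lemma abs_continuous_bounded_variation a b F : a <= b ->
  abs_continuous a b F -> bounded_variation a b F.
Proof.
move=> ab acF; have [d d0 dP] := abs_continuous_partition acF ltr01.
have step x y : a <= x -> y <= b -> x <= y -> y - x < d -> bounded_variation x y F.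
  move=> ax yb xy yxd; exists 1 => _ [s ps <-].
  rewrite /variation /= big_mkord; apply/ltW/(dP x y s xpredT) => //.
  by rewrite (sum_itv_partition id ps).
(* The division points advance by [d / 2] and stop at [b], reached after finitely many steps. *)
pose c n := Num.min b (a + n%:R * (d / 2)).
have acn n : a <= c n.
  by rewrite le_min ab lerDl mulr_ge0// divr_ge0// ltW.
have cb n : c n <= b by rewrite ge_min lexx.
have cS n : c n <= c n.+1.
  rewrite le_min cb/= ge_min lerD2l ler_wpM2r ?orbT//; first by rewrite divr_ge0// ltW.
  by rewrite ler_nat.
have bvc n : bounded_variation a (c n) F.
  elim: n => [|n ih].
    rewrite /c mul0r addr0 (min_idPr ab); exact: bounded_variationxx.
  apply/bounded_variationP => //.
  rewrite (total_variationD _ (acn n) (cS n)) fin_numD.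
  rewrite (bounded_variationP _ (acn n)).1//=.
  apply/(bounded_variationP _ (cS n)); apply: step => //.
  rewrite ltrBlDr /c -natr1 mulrDl mul1r.
  have [h|h] := leP b (a + n%:R * (d / 2)).
    by rewrite gt_min; apply/orP; left; lra.
  by rewrite gt_min; apply/orP; right; lra.
have [n hn] : exists n, c n = b.
  exists (Num.truncn ((b - a) / (d / 2))).+1; apply/min_idPl.
  rewrite -lerBlDl -ler_pdivrMr ?divr_gt0//.
  exact/ltW/truncnS_gt.
by rewrite -hn.
Qed.

End AbsoluteContinuity.

(** * Positive variation of absolutely continuous functions *)

Section PositiveVariation.
Context {R : realType}.
Implicit Types (a b x y : R) (F G : R -> R).

(** The increasing part of the Jordan decomposition: the half-sum retains the upward moves of F on
    [a, x] and cancels the downward ones. *)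
Definition positive_variation a F x :=
  (fine (total_variation a x F) + (F x - F a)) / 2.

Lemma positive_variationB a b F x y : bounded_variation a b F ->
  a <= x -> x <= y -> y <= b ->
  positive_variation a F y - positive_variation a F x =
  (fine (total_variation x y F) + (F y - F x)) / 2.
Proof.
move=> bvF ax xy yb; have ay := le_trans ax xy; have xb := le_trans xy yb.
have bvy : bounded_variation a y F := bounded_variationl ay yb bvF.
have fx : total_variation a x F \is a fin_num.
  by apply/bounded_variationP => //; exact: (bounded_variationl ax xb bvF).
have fxy : total_variation x y F \is a fin_num.
  by apply/bounded_variationP => //; exact: (bounded_variationr ax xy bvy).
rewrite /positive_variation (total_variationD F ax xy) fineD//; lra.
Qed.

Lemma positive_variation_homo a b F x y : bounded_variation a b F ->
  a <= x -> x <= y -> y <= b ->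
  positive_variation a F x <= positive_variation a F y.
Proof.
move=> bvF ax xy yb; rewrite -subr_ge0 (positive_variationB bvF)//.
apply: mulr_ge0 => //.
have fxy : total_variation x y F \is a fin_num.
  apply/bounded_variationP => //; apply: (bounded_variationr ax xy _).
  exact: (bounded_variationl (le_trans ax xy) yb bvF).
have := total_variation_ge F xy; rewrite -(fineK fxy) lee_fin.
have := ler_norm (F x - F y); rewrite distrC; lra.
Qed.

Lemma positive_variation_jordan a b F x : bounded_variation a b F ->
  a <= x -> x <= b ->
  positive_variation a F x - positive_variation a (\- F) x = F x - F a.
Proof.
by move=> bvF ax xb; rewrite /positive_variation total_variationN /=; lra.
Qed.

(** Subadditivity for F = (F - k z) + k z. The linear term adds k (y - x) to the total variation and
    k (y - x) to the increment, so the half-sum gains exactly k (y - x). *)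
Lemma positive_variation_le a b F k x y : abs_continuous a b F -> 0 <= k ->
  a <= x -> x <= y -> y <= b ->
  positive_variation a F y - positive_variation a F x <=
  k * (y - x) + (positive_variation a (fun z => F z - k * z) y -
                 positive_variation a (fun z => F z - k * z) x).
Proof.
move=> acF k0 ax xy yb; have ay := le_trans ax xy; have ab := le_trans ay yb.
have bv G : abs_continuous a b G -> bounded_variation x y G.
  move=> acG; apply: (bounded_variationr ax xy _).
  exact: (bounded_variationl ay yb (abs_continuous_bounded_variation ab acG)).
have bvF := abs_continuous_bounded_variation ab acF.
have acH : abs_continuous a b (fun z => F z - k * z) by exact: abs_continuousB_lin.
have bvH := abs_continuous_bounded_variation ab acH.
rewrite (positive_variationB bvF)// (positive_variationB bvH)//.
have ndk : {in `[x, y] &, nondecreasing_fun (fun z => k * z)}.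
  by move=> u v _ _ uv; exact: ler_wpM2l.
have := total_variation_le (fun z => F z - k * z) (fun z => k * z) xy.
rewrite (nondecreasing_total_variation xy ndk).
have -> : (fun z => F z - k * z) \+ (fun z => k * z) = F.
  by apply/funext => z /=; rewrite subrK.
have fF := (bounded_variationP _ xy).1 (bv _ acF).
have fH := (bounded_variationP _ xy).1 (bv _ acH).
rewrite -(fineK fF) -(fineK fH) -EFinD lee_fin; lra.
Qed.

(* In a partition, the cells where F increases by more than k times their length
   have total length at most TV(F)/k, so absolute continuity makes their total
   contribution small when k is large. *)
Lemma positive_variation_lin_small a b F e : a <= b ->
  abs_continuous a b F -> 0 < e -> exists2 k : R, 0 <= k &
  positive_variation a (fun z => F z - k * z) b <= e.
Proof.
move=> ab acF e0; have [d d0 dP] := abs_continuous_partition acF e0.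
have bvF := abs_continuous_bounded_variation ab acF.
have fF := (bounded_variationP _ ab).1 bvF.
set T := fine (total_variation a b F).
have T0 : 0 <= T by rewrite fine_ge0// total_variation_ge0.
(* With this slope the cells steeper than k, of total length at most T / k, have total length below
   d; the added 1 makes this strict. *)
have k0 : 0 < (T + 1) / d by rewrite divr_gt0// ltr_wpDl.
exists ((T + 1) / d); first exact: ltW.
set k := (T + 1) / d in k0 *; set H := fun z => F z - k * z.
have acH : abs_continuous a b H by exact: abs_continuousB_lin.
have fH := (bounded_variationP _ ab).1 (abs_continuous_bounded_variation ab acH).
(* Doubled, the positive variation of H is a supremum of sums of |dH| + dH, dH being the increment
   on a cell. Cells with dH <= 0 contribute nothing, the others at most 2 |dF|. *)
rewrite /positive_variation ler_pdivrMr// -lerBrDr -lee_fin fineK//.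
apply: ge_ereal_sup => _ [_ [s ps <-] <-]; rewrite lee_fin lerBrDr.
rewrite /variation big_mkord -(sum_itv_partition H ps) -big_split/=.
set X := nth b (a :: s).
have Xle (i : 'I_(size s)) : X i < X i.+1.
  by apply: (itv_partition_nth_lt ps); rewrite ltnSn ltn_ord.
pose P (i : 'I_(size s)) := 0 < H (X i.+1) - H (X i).
have PE i : P i -> k * (X i.+1 - X i) < F (X i.+1) - F (X i).
  by rewrite /P /H; lra.
rewrite (bigID P)/= [X in _ + X]big1 ?addr0; last first.
  by move=> i; rewrite /P -leNgt => h; rewrite ler0_norm// addNr.
apply: (@le_trans _ _ (\sum_(i < size s | P i) `|F (X i.+1) - F (X i)| * 2)).
  apply: ler_sum => i /[dup] Pi /PE h.
  have : 0 < k * (X i.+1 - X i) by rewrite mulr_gt0// subr_gt0.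
  move: Pi; rewrite /P => Pi k1; rewrite (gtr0_norm Pi).
  have := ler_norm (F (X i.+1) - F (X i)).
  by rewrite -[nth b s i]/(X i.+1) /H; lra.
rewrite -mulr_suml ler_wpM2r//; apply/ltW/(dP a b s P) => //.
have : \sum_(i < size s | P i) k * (X i.+1 - X i) <= T.
  apply: (@le_trans _ _ (variation a b F s)).
    rewrite /variation big_mkord [leRHS](bigID P)/= -[leLHS]addr0.
    apply: lerD; last exact: sumr_ge0.
    by apply: ler_sum => i /PE/ltW/le_trans -> //; exact: ler_norm.
  rewrite -lee_fin fineK//; apply: ereal_sup_ubound.
  by exists (variation a b F s) => //; exact: variations_variation.
rewrite -mulr_sumr /k mulrAC ler_pdivrMr// => h.
rewrite ltNge; apply/negP => h'.
have : (T + 1) * d <= T * d by apply: le_trans h; rewrite ler_wpM2l// addr_ge0.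
by rewrite ler_pM2r//; lra.
Qed.

(** Subtracting a steep enough linear term leaves at most e / 2 of positive variation on all of
    [a, b], and the linear term contributes k (y - x). This yields the right continuity required of
    a [cumulative] function. *)
Lemma positive_variation_uniform a b F e : abs_continuous a b F -> 0 < e ->
  exists2 d : R, 0 < d & forall x y, a <= x -> x <= y -> y <= b -> y - x < d ->
    positive_variation a F y - positive_variation a F x < e.
Proof.
move=> acF e0; have [ab|ba] := leP a b; last first.
  exists 1 => // x y ax xy yb; have := le_trans ax (le_trans xy yb).
  by rewrite leNgt ba.
have [k k0 kP] := positive_variation_lin_small ab acF (divr_gt0 e0 (ltr0Sn _ 1)).
have k1 : 0 < k + 1 by rewrite ltr_wpDl.
exists (e / 2 / (k + 1)); first by rewrite !divr_gt0.
move=> x y ax xy yb; rewrite ltr_pdivlMr// => h.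
have acH : abs_continuous a b (fun z => F z - k * z) by exact: abs_continuousB_lin.
have bvH := abs_continuous_bounded_variation ab acH.
apply: le_lt_trans (positive_variation_le acF k0 ax xy yb) _.
have h1 := positive_variation_homo bvH (lexx a) ax (le_trans xy yb).
have h2 := positive_variation_homo bvH (le_trans ax xy) yb (lexx b).
have h3 : positive_variation a (fun z : R => F z - k * z) a = 0.
  by rewrite /positive_variation total_variationxx subrr addr0 mul0r.
have h4 : k * (y - x) <= (y - x) * (k + 1).
  by rewrite mulrC ler_wpM2l ?subr_ge0// lerDl.
lra.
Qed.

End PositiveVariation.

(** * Lebesgue-Stieltjes measures with a density *)

Section LebesgueStieltjesDensity.
Context {R : realType}.
Notation mu := (@lebesgue_measure R).
Local Notation LS := (@lebesgue_stieltjes_measure R).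
Implicit Types (f p q w : cumulative R R).

Lemma lebesgue_stieltjes_oc f (x y : R) : x <= y ->
  LS f `]x, y]%classic = (f y - f x)%:E.
Proof.
move=> xy; rewrite /lebesgue_stieltjes_measure /measure_extension.
rewrite measurable_mu_extE/=; last exact: is_ocitv.
by rewrite wlength_itv_bnd.
Qed.

(** Both sides are Stieltjes measures of the same function, so they agree on half-open intervals and
    hence everywhere. The additive form replaces a subtraction of measures. *)
Lemma lebesgue_stieltjes_add f q p (k : {nonneg R}) A : measurable A ->
  (forall x, f x + q x = k%:num * x + p x) ->
  (LS f A + LS q A = k%:num%:E * mu A + LS p A)%E.
Proof.
move=> mA fq.
pose w0 x := f x + q x.
have w_nd : nondecreasing w0.
  by move=> x y xy; apply: lerD; exact: cumulative_is_nondecreasing.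
have w_rc : right_continuous w0.
  by move=> x; apply: cvgD; exact: cumulative_is_right_continuous.
pose w : cumulative R R := HB.pack w0 (isCumulative.Build R _ R w0 w_nd w_rc).
have <- : LS w A = (LS f A + LS q A)%E.
  rewrite -measure_addE; apply: lebesgue_stieltjes_measure_unique => // X.
  move=> /ocitvP[->|[[x y]/= xy ->]]; first by rewrite !measure0.
  rewrite [RHS]measure_addE /= !lebesgue_stieltjes_oc ?(ltW xy)// -EFinD.
  by congr EFin; rewrite /= /w0; ring.
transitivity (measure_add (mscale k mu) (LS p) A); last by rewrite measure_addE.
apply: lebesgue_stieltjes_measure_unique => // X.
move=> /ocitvP[->|[[x y]/= xy ->]]; first by rewrite !measure0.
rewrite [RHS]measure_addE /= /mscale /= [X in (_ * X)%E]lebesgue_stieltjes_oc ?(ltW xy)//.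
rewrite !lebesgue_stieltjes_oc ?(ltW xy)// -EFinM -EFinD.
by congr EFin; rewrite /= /w0 !fq; ring.
Qed.

Lemma lebesgue_stieltjes_le f (e : R) A : measurable A ->
  (forall x y, f y - f x <= e) -> (LS f A <= e%:E)%E.
Proof.
move=> mA fe; apply: (@le_trans _ _ (LS f setT)).
  by apply: le_measure; rewrite ?inE//; exact: measurableT.
rewrite -(bigcup_itvT false false).
pose I n : set R := `]- (n%:R), n%:R]%classic.
have : (LS f \o I) n @[n --> \oo] --> LS f (\bigcup_n I n).
  apply: nondecreasing_cvg_mu; rewrite /I//; first exact: bigcup_measurable.
  by move=> *; apply/subsetPset/subset_itv; rewrite leBSide/= ?lerN2 ler_nat.
move/cvg_lim => <- //; apply: lime_le.
  apply: ereal_nondecreasing_is_cvgn => m n mn; apply: le_measure.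
  - by apply/mem_set; exact: measurable_itv.
  - by apply/mem_set; exact: measurable_itv.
  by apply: subset_itv; rewrite leBSide/= ?lerN2 ler_nat.
near=> n; rewrite /= /I lebesgue_stieltjes_oc ?lee_fin//.
by rewrite (@le_trans _ _ 0)// oppr_le0.
Unshelve. all: by end_near. Qed.

(** The gap q(x) = k x + p(x) - f(x) is nondecreasing by hypothesis, and LS f + LS q = k mu + LS p.
    On a Lebesgue null set only LS p remains on the right, and its total mass is at most e. *)
Lemma lebesgue_stieltjes_dominated f :
  (forall e : R, 0 < e -> exists k, 0 <= k /\ exists2 p : cumulative R R,
    (forall x y, x <= y -> f y - f x <= k * (y - x) + (p y - p x)) &
    (forall x y, p y - p x <= e)) ->
  LS f `<< mu.
Proof.
move=> H; apply/null_content_dominatesP => A mA muA0.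
apply/eqP; rewrite eq_le measure_ge0 andbT; apply/lee_addgt0Pr => e e0.
rewrite add0e; have [k [k0 [p fkp pe]]] := H _ e0.
pose q0 x := k * x + p x - f x.
have q_nd : nondecreasing q0.
  by move=> x y /fkp; rewrite /q0; lra.
have q_rc : right_continuous q0.
  move=> x; apply: cvgB; last exact: cumulative_is_right_continuous.
  apply: cvgD; last exact: cumulative_is_right_continuous.
  by apply: cvg_within_filter; apply: cvgM; [exact: cvg_cst|exact: cvg_id].
pose q : cumulative R R := HB.pack q0 (isCumulative.Build R _ R q0 q_nd q_rc).
apply: (@le_trans _ _ (LS f A + LS q A)%E); first by rewrite leeDl.
rewrite (@lebesgue_stieltjes_add f q p (NngNum k0))//; last first.
  by move=> x /=; rewrite /q0; ring.
by rewrite muA0 mule0 add0e; exact: lebesgue_stieltjes_le.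
Qed.

Lemma lebesgue_stieltjes_density f (M : R) : LS f `<< mu ->
  (forall x y, f y - f x <= M) ->
  exists2 g : R -> R, mu.-integrable setT (EFin \o g) &
    forall x y, x <= y -> f y - f x = \int[mu]_(t in `]x, y]) g t.
Proof.
move=> fmu fM.
have fin : fin_num_fun (LS f).
  by move=> A mA; rewrite ge0_fin_numE ?measure_ge0//
    (le_lt_trans (lebesgue_stieltjes_le mA fM))// ltry.
pose nu : {finite_measure set (measurableTypeR R) -> \bar R} :=
  HB.pack (LS f) (@isFinite.Build _ _ _ (LS f) fin).
have [g [g0 gfin ig gE]] := @radon_nikodym_sigma_finite _ _ _ mu nu fmu.
have gK : EFin \o (fine \o g) = g by apply/funext => x /=; rewrite fineK.
exists (fine \o g); first by rewrite gK.
move=> x y xy; rewrite /Rintegral -[X in fine (integral _ _ X)]/(EFin \o (fine \o g)) gK -gE//.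
by rewrite [nu _]lebesgue_stieltjes_oc.
Qed.

End LebesgueStieltjesDensity.

(** * The fundamental theorem of calculus for absolutely continuous functions *)

Section FundamentalTheorem.
Context {R : realType}.
Notation mu := (@lebesgue_measure R).
Implicit Types (a b x y : R) (F : R -> R).

(** Projection onto [a, b]. Composition with it extends a function by constants to the whole line,
    where [cumulative] functions live, and keeps its increments bounded. *)
Let clip a b x := Num.max a (Num.min b x).

Let clip_itv a b x : a <= b -> a <= clip a b x <= b.
Proof. by move=> ab; rewrite /clip le_max lexx/= ge_max ab ge_min lexx. Qed.

Let clip_id a b x : a <= x -> x <= b -> clip a b x = x.
Proof. by move=> ax xb; rewrite /clip (min_idPr xb) (max_idPr ax). Qed.

Let clip_homo a b x y : x <= y -> clip a b x <= clip a b y.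
Proof.
move=> xy; rewrite /clip ge_max le_max lexx/= le_max; apply/orP; right.
by rewrite le_min !ge_min lexx xy orbT.
Qed.

Let clip_lip a b x y : x <= y -> clip a b y - clip a b x <= y - x.
Proof.
move=> xy; rewrite /clip.
have : Num.min b x <= Num.min b y.
  by rewrite le_min !ge_min lexx xy orbT.
have : Num.min b y - Num.min b x <= y - x.
  by case: (leP b y); case: (leP b x) => *; lra.
set u := Num.min b x; set v := Num.min b y.
by case: (leP a v); case: (leP a u) => *; lra.
Qed.

Let pvclip a b F : a <= b -> abs_continuous a b F ->
  exists P : cumulative R R, forall x, P x = positive_variation a F (clip a b x).
Proof.
move=> ab acF; pose P x := positive_variation a F (clip a b x).
have bvF := abs_continuous_bounded_variation ab acF.
have nd : nondecreasing P.
  move=> x y xy; have /andP[ax _] := clip_itv x ab.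
  have /andP[_ yb] := clip_itv y ab.
  by apply: (positive_variation_homo bvF) => //; exact: clip_homo.
have rc : right_continuous P.
  move=> x; apply/cvgrPdist_lt => e e0.
  have [d d0 dP] := positive_variation_uniform acF e0.
  near=> y; have xy : x <= y by near: y; exact: nbhs_right_ge.
  have ? : y - x < d by rewrite ltrBlDr addrC; near: y; apply: nbhs_right_lt; rewrite ltrDl.
  rewrite distrC ger0_norm ?subr_ge0//; last exact: nd.
  have /andP[ax _] := clip_itv x ab; have /andP[_ yb] := clip_itv y ab.
  by apply: dP => //; [exact: clip_homo|exact: le_lt_trans (clip_lip _ _ xy) _].
pose c : cumulative R R := HB.pack P (isCumulative.Build R _ R P nd rc).
by exists c.
Unshelve. all: by end_near. Qed.

(** The domination criterion is met with p the clipped positive variation of F - k z, whose total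
    increase is at most e for a suitable k. *)
Let pv_density a b F : a <= b -> abs_continuous a b F ->
  exists2 g : R -> R, mu.-integrable setT (EFin \o g) &
    forall x y, a <= x -> x <= y -> y <= b ->
      positive_variation a F y - positive_variation a F x =
      \int[mu]_(t in `]x, y]) g t.
Proof.
move=> ab acF; have [P PE] := pvclip ab acF.
have bound G (p : cumulative R R) : abs_continuous a b G ->
    (forall x, p x = positive_variation a G (clip a b x)) ->
    forall x y, p y - p x <= positive_variation a G b.
  move=> acG pE x y; rewrite !pE.
  have bvG := abs_continuous_bounded_variation ab acG.
  have /andP[ax xb] := clip_itv x ab; have /andP[ay yb] := clip_itv y ab.
  have := positive_variation_homo bvG ay yb (lexx b).
  have := positive_variation_homo bvG (lexx a) ax xb.
  by rewrite {1}/positive_variation total_variationxx subrr addr0 mul0r; lra.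
have [] := @lebesgue_stieltjes_density _ P (positive_variation a F b).
- apply: lebesgue_stieltjes_dominated => e e0.
  have [k k0 kP] := positive_variation_lin_small ab acF e0.
  have acH : abs_continuous a b (fun z => F z - k * z) by exact: abs_continuousB_lin.
  have [p pE] := pvclip ab acH.
  exists k; split => //; exists p => [x y xy|x y]; last first.
    by apply: le_trans kP; exact: bound.
  rewrite !PE !pE.
  have /andP[ax _] := clip_itv x ab; have /andP[_ yb] := clip_itv y ab.
  apply: (le_trans (positive_variation_le acF k0 ax (clip_homo _ _ xy) yb)).
  by rewrite lerD2r ler_wpM2l// clip_lip.
- exact: bound.
move=> g ig gE; exists g => // x y ax xy yb; rewrite -gE// !PE.
by rewrite !clip_id//; [exact: le_trans xy yb|exact: le_trans ax xy].
Qed.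

Lemma abs_continuous_integral a b F : a <= b -> abs_continuous a b F ->
  exists2 g : R -> R, mu.-integrable setT (EFin \o g) &
    forall x y, a <= x -> x <= y -> y <= b ->
      F y - F x = \int[mu]_(t in `]x, y]) g t.
Proof.
move=> ab acF; have acNF := abs_continuousN acF.
have [g ig gE] := pv_density ab acF; have [h ih hE] := pv_density ab acNF.
exists (fun x => g x - h x) => [|x y ax xy yb].
  rewrite [X in mu.-integrable _ X](_ : _ = (EFin \o g) \- (EFin \o h))%E//.
  exact: integrableB.
rewrite RintegralB//=; [|exact: (integrableS measurableT)..].
rewrite -gE// -hE//; have bvF := abs_continuous_bounded_variation ab acF.
have := positive_variation_jordan bvF ax (le_trans xy yb).
have := positive_variation_jordan bvF (le_trans ax xy) yb; lra.
Qed.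

Lemma ae_neq (c : R) : {ae mu, forall x, x != c}.
Proof.
exists [set c]; split => [||x /= /negP]; first exact: measurable_set1.
  exact: lebesgue_measure_set1.
by rewrite negbK => /eqP.
Qed.

(** Near an interior point F is a constant plus the integral of g, so Lebesgue's differentiation
    theorem applies. F is uncontrolled beyond the endpoints, which are discarded as a null set. *)
Lemma derive1_integral_ae a b F (g : R -> R) :
  mu.-integrable setT (EFin \o g) ->
  (forall x, a <= x -> x <= b -> F x - F a = \int[mu]_(t in `]a, x]) g t) ->
  {ae mu, forall x, x \in `[a, b] -> derive1 F x = g x}.
Proof.
move=> ig FE.
have igy y : mu.-integrable [set` Interval (BRight a) (BRight y)] (EFin \o g).
  by apply: integrableS ig => //; exact: measurable_itv.
have lg : locally_integrable [set: R] g.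
  by apply: open_integrable_locally => //; exact: openT.
have := FTC1 igy lg; set I := fun x => _.
apply: (@filterS3 _ _ (ae_filter_ringOfSetsType mu) _ _ _ _ _ (ae_neq a) (ae_neq b)) => x xa xb; rewrite in_itv/=.
move=> H /andP[]; rewrite !le_eqVlt eq_sym (negPf xa) (negPf xb)/= => ax bx.
have [dx <-] := H ax.
rewrite !derive1E (@near_eq_derive _ _ _ F (cst (F a) \+ I)).
  have dc : derivable (cst (F a)) x 1 by exact: derivable_cst.
  by rewrite (deriveD dc dx) derive_cst add0r.
near=> y; rewrite /= /I -FE; [by rewrite addrC subrK| |]; apply/ltW; near: y.
  exact: lt_nbhsr.
exact: lt_nbhsl.
Unshelve. all: by end_near. Qed.

End FundamentalTheorem.

(** * Integrals and null sets *)

Section ModificationOnNullSet.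
Import HBNNSimple.
Context d (T : measurableType d) (R : realType).
Variable mu : {measure set T -> \bar R}.
Local Open Scope ereal_scope.

(* No measurability is assumed: the integral of a nonnegative function is a
   supremum of integrals of simple functions, which may be cut off on a null
   set. *)
Let ge0_integralT_le (f g : T -> \bar R) (N : set T) :
  (forall x, 0 <= f x) -> (forall x, 0 <= g x) ->
  measurable N -> mu N = 0 -> (forall x, ~ N x -> f x = g x) ->
  \int[mu]_x f x <= \int[mu]_x g x.
Proof.
move=> f0 g0 mN N0 fg; rewrite (ge0_integralTE mu f0).
apply: ge_ereal_sup => _ [h /= hf <-].
rewrite -integralT_nnsfun (ge0_negligible_integral mN measurableT); [| |by move=> x _; rewrite lee_fin|by []]; last first.
  exact/measurable_EFinP/measurable_funTS.
rewrite setTD integral_nnsfun; last exact: measurableC.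
rewrite (mrestrict _ (measurableC mN)) (ge0_integralTE mu g0).
apply: ereal_sup_ubound; exists (proj_nnsfun h (measurableC mN)) => //= x.
rewrite mindicE in_setC; have [xN|] /= := boolP (x \in N).
  by rewrite mulr0.
by rewrite notin_setE => xN; rewrite mulr1 -fg.
Qed.

(** Positive and negative parts are each compared in both directions. The lemma serves where an
    inner integral or a derivative is known only almost everywhere. *)
Lemma integral_modif D (f g : T -> \bar R) (N : set T) :
  measurable N -> mu N = 0 -> (forall x, D x -> ~ N x -> f x = g x) ->
  \int[mu]_(x in D) f x = \int[mu]_(x in D) g x.
Proof.
move=> mN N0 fg; rewrite integralE [RHS]integralE.
by congr (_ - _); rewrite integral_mkcond [RHS]integral_mkcond;
  apply/eqP; rewrite eq_le; apply/andP; split; apply: ge0_integralT_le mN N0 _ => x;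
  rewrite ?patchE; case: ifPn => // /set_mem Dx Nx; rewrite ?funeposE ?funenegE fg.
Qed.

Lemma ae_eq_RintegralT D (f g : T -> R) :
  {ae mu, forall x, D x -> f x = g x} ->
  (\int[mu]_(x in D) f x = \int[mu]_(x in D) g x)%R.
Proof.
move=> [N [mN N0 fgN]]; congr fine; apply: (integral_modif mN N0) => x Dx Nx.
by congr EFin; apply: contrapT => fg; apply/Nx/fgN => /(_ Dx).
Qed.
End ModificationOnNullSet.

(** * Convolution of nonnegative functions *)

Section AffineChangeOfVariable.
Context {R : realType}.
Notation mu := (@lebesgue_measure R).

Lemma measurable_affine (c d : R) : measurable_fun setT (fun x : R => c * x + d).
Proof. by apply: measurable_funD => //; exact: measurable_funM. Qed.

Let measurable_affineT (c d : R) : measurable_fun [set: measurableTypeR R]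
  ((fun x => c * x + d) : measurableTypeR R -> measurableTypeR R).
Proof. exact: measurable_affine. Qed.

Lemma lebesgue_measure_affine (c d : R) (A : set (measurableTypeR R)) :
  c != 0 -> measurable A ->
  mu A = (`|c|%:E * mu ((fun x => c * x + d)%R @^-1` A))%E.
Proof.
move=> c0 mA; pose push : {measure set (measurableTypeR R) -> \bar R} :=
  mscale (NngNum (normr_ge0 c)) (@pushforward _ _
    (measurableTypeR R) (measurableTypeR R) R mu (fun x => c * x + d)).
rewrite -[RHS]/(push (measurable_affineT c d) A); apply: lebesgue_measure_unique => // X.
move=> /ocitvP[->|[[x y]/= xy ->]]; first by rewrite !measure0.
rewrite -[RHS]/(`|c|%:E * mu ((fun x => c * x + d)%R @^-1` `]x, y]%classic))%E.
rewrite lebesgue_measure_itv/= lte_fin xy.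
have [c_gt0|c_lt0|] := ltgtP 0 c; last by move=> /esym/eqP; rewrite (negPf c0).
  rewrite (_ : _ @^-1` _ = `](x - d) / c, (y - d) / c]%classic); last first.
    by apply/seteqP; split => z /=; rewrite !in_itv/= ltr_pdivrMr// ler_pdivlMr//
      ltrBlDr lerBrDr mulrC.
  rewrite lebesgue_measure_itv/= lte_fin ltr_pM2r ?invr_gt0// ltrD2r xy.
  rewrite -EFinD -EFinM gtr0_norm//; congr EFin; field.
  by rewrite gt_eqF.
rewrite (_ : _ @^-1` _ = `[(y - d) / c, (x - d) / c[%classic); last first.
  by apply/seteqP; split => z /=; rewrite !in_itv/= ler_ndivrMr// ltr_ndivlMr//
      ltrBlDr lerBrDr mulrC andbC.
rewrite lebesgue_measure_itv/= lte_fin ltr_nM2r ?invr_lt0// ltrD2r xy.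
rewrite -EFinD -EFinM ltr0_norm//; congr EFin; field.
by rewrite lt_eqF.
Qed.

Local Open Scope ereal_scope.

Lemma ge0_integral_affine (c d : R) (g : R -> \bar R) : c != 0%R ->
  measurable_fun setT g -> (forall x, 0 <= g x) ->
  \int[mu]_x g x = `|c|%:E * \int[mu]_x g (c * x + d)%R.
Proof.
move=> c0 mg g0; pose k := NngNum (normr_ge0 c).
rewrite (eq_measure_integral (mscale k (@pushforward _ _
    (measurableTypeR R) (measurableTypeR R) R mu (fun x => c * x + d)%R))); last first.
  by move=> A mA _; exact: lebesgue_measure_affine.
rewrite ge0_integral_mscale//; congr (_ * _).
by rewrite ge0_integral_pushforward.
Qed.

Lemma ge0_integral_reflect (x : R) (g : R -> \bar R) :
  measurable_fun setT g -> (forall x, 0 <= g x) ->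
  \int[mu]_y g (x - y)%R = \int[mu]_y g y.
Proof.
move=> mg g0; rewrite [RHS](@ge0_integral_affine (-1) x)// ?oppr_eq0 ?oner_eq0//.
rewrite normrN1 mul1e; apply: eq_integral => y _.
by congr g; rewrite mulN1r addrC.
Qed.

Lemma ge0_integral_translate (x : R) (g : R -> \bar R) :
  measurable_fun setT g -> (forall x, 0 <= g x) ->
  \int[mu]_y g (y - x)%R = \int[mu]_y g y.
Proof.
move=> mg g0; rewrite [RHS](@ge0_integral_affine 1 (- x))// ?oner_eq0//.
by rewrite normr1 mul1e; apply: eq_integral => y _; rewrite mul1r.
Qed.

End AffineChangeOfVariable.

Section Convolution.
Context {R : realType}.
Notation mu := (@lebesgue_measure R).
Local Open Scope ereal_scope.
Implicit Types f g h : R -> \bar R.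

Definition convolution f g x := \int[mu]_y (f y * g (x - y)%R).

(** What Tonelli's theorem asks for: commutativity and associativity then hold with infinite values
    allowed. Functions on the half-line are represented by kernels vanishing for t <= 0, so that
    convolutions run over the whole line. *)
Definition kernel f := measurable_fun setT f /\ forall x, 0 <= f x.

Lemma measurable_sub2 g (u v : R * R -> R) : measurable_fun setT g ->
  measurable_fun setT u -> measurable_fun setT v ->
  measurable_fun setT (fun z : R * R => g (u z - v z)%R).
Proof.
by move=> mg mu_ mv; apply: (measurableT_comp mg); exact: measurable_funB.
Qed.

Lemma convolution_ge0 f g x : kernel f -> kernel g -> 0 <= convolution f g x.
Proof. by move=> [_ f0] [_ g0]; apply: integral_ge0 => y _; exact: mule_ge0. Qed.

Let measurable_conv2 f g : kernel f -> kernel g ->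
  measurable_fun setT (fun z : R * R => f z.2 * g (z.1 - z.2)%R).
Proof.
move=> [mf _] [mg _]; apply: emeasurable_funM.
  exact: measurableT_comp mf _.
exact: measurable_sub2.
Qed.

Lemma kernel_convolution f g : kernel f -> kernel g -> kernel (convolution f g).
Proof.
move=> kf kg; split; last by move=> x; exact: convolution_ge0.
apply: (@measurable_fun_fubini_tonelli_F _ _ _ _ _ mu
  (fun z : R * R => f z.2 * g (z.1 - z.2)%R)).
  exact: measurable_conv2.
by move=> z; apply: mule_ge0; [exact: kf.2|exact: kg.2].
Qed.

Lemma convolutionC f g : kernel f -> kernel g ->
  convolution f g = convolution g f.
Proof.
move=> [mf f0] [mg g0]; apply/funext => x; rewrite /convolution.
rewrite -(@ge0_integral_reflect _ x)//=.
- by apply: eq_integral => y _; rewrite muleC opprB addrC subrK.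
- apply: emeasurable_funM => //; apply: (measurableT_comp mg).
  exact: measurable_funB.
- by move=> y; exact: mule_ge0.
Qed.

Lemma convolutionA f g h : kernel f -> kernel g -> kernel h ->
  convolution (convolution f g) h = convolution f (convolution g h).
Proof.
move=> kf kg kh; apply/funext => x.
have [mf f0] := kf; have [mg g0] := kg; have [mh h0] := kh.
transitivity (\int[mu]_z \int[mu]_y (f y * g (z - y)%R * h (x - z)%R)).
  apply: eq_integral => z _; rewrite -ge0_integralZr//.
  - apply: emeasurable_funM => //; apply: (measurableT_comp mg).
    exact: measurable_funB.
  - by move=> y _; exact: mule_ge0.
rewrite (@fubini_tonelli _ _ _ _ _ mu mu (fun z : R * R => f z.2 * g (z.1 - z.2)%R * h (x - z.1)%R)); last 2 first.
- apply: emeasurable_funM; first exact: measurable_conv2.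
  exact: measurable_sub2.
- by move=> z; rewrite !mule_ge0.
apply: eq_integral => y _ /=; rewrite /convolution.
rewrite -(ge0_integral_translate y)//=; last 2 first.
- apply: emeasurable_funM => //; apply: (measurableT_comp mh).
  exact: measurable_funB.
- by move=> z; exact: mule_ge0.
rewrite -ge0_integralZl//; last 2 first.
- apply: emeasurable_funM; first by apply: (measurableT_comp mg); exact: measurable_funB.
  apply: (measurableT_comp mh).
  by do 2 apply: measurable_funB => //.
- by move=> z _; exact: mule_ge0.
by apply: eq_integral => z _; rewrite muleA opprB addrA subrK.
Qed.

Lemma integral_convolution f g : kernel f -> kernel g ->
  \int[mu]_x convolution f g x = (\int[mu]_x f x) * (\int[mu]_x g x).
Proof.
move=> kf kg; have [mf f0] := kf; have [mg g0] := kg.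
rewrite (@fubini_tonelli _ _ _ _ _ mu mu (fun z : R * R => f z.2 * g (z.1 - z.2)%R)); last 2 first.
- exact: measurable_conv2.
- by move=> z; rewrite !mule_ge0.
rewrite -ge0_integralZr//; last exact: integral_ge0.
apply: eq_integral => y _ /=; rewrite ge0_integralZl//; last first.
  by apply: (measurableT_comp mg); exact: measurable_funB.
by rewrite ge0_integral_translate.
Qed.

Lemma convolutionDl f g h x : kernel f -> kernel g -> kernel h ->
  convolution (f \+ g) h x = convolution f h x + convolution g h x.
Proof.
move=> [mf f0] [mg g0] [mh h0]; rewrite -ge0_integralD//.
- by apply: eq_integral => y _; rewrite ge0_muleDl.
- by move=> y _; exact: mule_ge0.
- apply: emeasurable_funM => //; apply: (measurableT_comp mh).
  exact: measurable_funB.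
- by move=> y _; exact: mule_ge0.
- apply: emeasurable_funM => //; apply: (measurableT_comp mh).
  exact: measurable_funB.
Qed.

Lemma le_convolutionr f g h x : kernel f -> kernel g -> kernel h ->
  (forall y, g y <= h y) -> convolution f g x <= convolution f h x.
Proof.
move=> [mf f0] [mg g0] [mh h0] gh; apply: ge0_le_integral => //.
- by move=> y _; exact: mule_ge0.
- apply: emeasurable_funM => //; apply: (measurableT_comp mg).
  exact: measurable_funB.
- apply: emeasurable_funM => //; apply: (measurableT_comp mh).
  exact: measurable_funB.
- by move=> y _; exact: lee_wpmul2l.
Qed.

End Convolution.

(** * The Gamma convolution semigroup *)

Section GammaKernel.
Context {R : realType}.
Notation mu := (@lebesgue_measure R).
Implicit Types s r t x : R.

(* The Gamma integrand t^(s-1) e^(-t), extended by 0 to t <= 0. *)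
Definition gamma_kernel s t : R :=
  if 0 < t then expR ((s - 1) * ln t - t) else 0.

Lemma gamma_kernel_ge0 s t : 0 <= gamma_kernel s t.
Proof. by rewrite /gamma_kernel; case: ifP => // _; exact: expR_ge0. Qed.

Lemma gamma_kernelE s t : 0 < t -> gamma_kernel s t = t `^ (s - 1) * expR (- t).
Proof. by move=> t0; rewrite /gamma_kernel t0 expRD /powR gt_eqF. Qed.

Lemma measurable_gamma_kernel2 :
  measurable_fun setT (fun z : R * R => gamma_kernel z.1 z.2).
Proof.
apply: measurable_fun_ifT => //=; first exact: measurable_fun_ltr.
apply: measurableT_comp => //; apply: measurable_funB => //.
apply: measurable_funM; first exact: measurable_funB.
exact: measurableT_comp.
Qed.

Lemma measurable_gamma_kernel s : measurable_fun setT (gamma_kernel s).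
Proof.
exact: measurable_fun_pair2 measurable_gamma_kernel2.
Qed.

Lemma kernel_gamma_kernel s : kernel (EFin \o gamma_kernel s).
Proof.
split; first by apply/measurable_EFinP; apply: measurable_gamma_kernel.
by move=> t; rewrite lee_fin gamma_kernel_ge0.
Qed.

(** The extended value can be handled before its finiteness is known; [Gamma] is its [fine], which
    would be 0 for an infinite integral. *)
Definition egamma s : \bar R := (\int[mu]_t (gamma_kernel s t)%:E)%E.

Lemma GammaE s : Gamma s = fine (egamma s).
Proof.
rewrite /Gamma Rintegral_mkcond; congr fine; apply: eq_integral => t _.
rewrite patchE; congr EFin; case: ifPn => [|].
  by rewrite inE/= in_itv/= andbT => /gamma_kernelE.
rewrite notin_setE/= in_itv/= andbT => /negP/negPf t0.
by rewrite /gamma_kernel t0.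
Qed.

Lemma integral_power01 s : 0 < s ->
  (\int[mu]_(t in `]0%R, 1%R]) (t `^ (s - 1))%:E = (s^-1)%:E)%E.
Proof.
move=> s0.
have I (e : R) : 0 < e -> e < 1 ->
    (\int[mu]_(t in `[e, 1%R]) (t `^ (s - 1))%:E = (s^-1 - e `^ s / s)%:E)%E.
  move=> e0 e1; pose F t := s^-1 *: t `^ s.
  have dF t : 0 < t -> is_derive t 1 F (t `^ (s - 1)).
    move=> t0; apply: (is_derive_eq (is_deriveZ s^-1 (is_derive1_powR s t0))).
    by rewrite /GRing.scale/= mulKf ?gt_eqF.
  have cF t : 0 < t -> {for t, continuous F}.
    move=> /dF[+ _]; move/derivable1_diffP/differentiable_continuous; exact.
  rewrite (@continuous_FTC2 _ _ F)//.
  - by rewrite /F powR1 -EFinB /GRing.scale/= mulr1 [_ * s^-1]mulrC.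
  - apply: continuous_in_subspaceT => t; rewrite inE/= in_itv/= => /andP[et _].
    have /derivable_powR : t \in `]0, +oo[ by rewrite in_itv/= andbT (lt_le_trans e0).
    by move=> /(_ 1 (s - 1))/derivable1_diffP/differentiable_continuous; exact.
  - split.
    + by move=> t /[!in_itv]/= /andP[et _]; have [] := dF _ (lt_trans e0 et).
    + by apply: cvg_at_right_filter; exact: cF.
    + by apply: cvg_at_left_filter; exact: cF.
  - move=> t /[!in_itv]/= /andP[et _]; rewrite derive1E.
    by have [_ ->] := dF _ (lt_trans e0 et).
(* The integrand may be singular at 0, so []0, 1]] is exhausted by closed intervals. Starting the
   denominators at 2 keeps [e n] strictly below 1. *)
pose e n : R := n.+2%:R^-1.
have e0 n : 0 < e n by rewrite invr_gt0.
have e1 n : e n < 1 by rewrite invf_lt1// ltr1n.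
rewrite (_ : `]0, 1]%classic = \bigcup_n `[e n, 1]%classic); last first.
  apply/seteqP; split => [t /=|t [n _]]/=; rewrite !in_itv/= => /andP[t0 t1].
    exists (Num.truncn t^-1) => //=; rewrite in_itv/= t1 andbT /e.
    rewrite invf_ple ?posrE//; apply/ltW/(lt_trans (truncnS_gt _)).
    by rewrite ltr_nat.
  by rewrite t1 andbT (lt_le_trans (e0 n)).
have nd : nondecreasing_seq (fun n => `[e n, 1]%classic).
  move=> m n mn; apply/subsetPset => t /=; rewrite !in_itv/= => /andP[+ ->].
  by rewrite andbT; apply: le_trans; rewrite lef_pV2 ?posrE// ler_nat.
have := @ge0_nondecreasing_set_cvg_integral _ _ _ _
  (fun t : measurableTypeR R => (t `^ (s - 1))%:E) mu nd.
move=> /(_ (fun n => measurable_itv _)) /=.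
have mp n : measurable_fun [set` `[e n, 1]] (fun t : measurableTypeR R => (t `^ (s - 1))%:E).
  by apply/measurable_EFinP; apply: measurable_funTS; exact: measurable_powR.
move=> /(_ mp).
have p0 n t : [set` `[e n, 1]] t -> (0%:E <= (t `^ (s - 1))%:E)%E.
  by rewrite lee_fin powR_ge0.
move=> /(_ p0) /cvg_lim <- //.
apply/cvg_lim => //.
under eq_fun do rewrite I//.
apply/cvg_EFin; first by near=> n.
rewrite -[X in _ --> X]subr0; apply: cvgB; first exact: cvg_cst.
rewrite -[X in _ --> X](mul0r s^-1); apply: cvgM; last exact: cvg_cst.
have /cvg_at_rightP := powR_cvg0 s0; apply; split => //.
by rewrite /e; have := @cvg_harmonic R; rewrite -cvg_shiftS.
Unshelve. all: by end_near. Qed.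

Lemma integral_expR_tail r c : 0 < r ->
  (\int[mu]_(t in `[c, +oo[) (expR (- (r * t)))%:E = (expR (- (r * c)) / r)%:E)%E.
Proof.
move=> r0; pose F t := - r^-1 *: expR (- (r * t)).
have dF t : is_derive t 1 F (expR (- (r * t))).
  have d1 : is_derive t 1 (fun t => - (r * t)) (- (r * 1)).
    by apply: is_deriveN; apply: is_deriveZ; exact: is_derive_id.
  have d2 := @is_derive1_comp _ expR (fun t => - (r * t)) t _ _ (is_derive_expR _) d1.
  apply: (is_derive_eq (is_deriveZ (- r^-1) d2)).
  by rewrite /GRing.scale/=; field; rewrite gt_eqF.
have cF t : {for t, continuous F}.
  have [+ _] := dF t.
  by move/derivable1_diffP/differentiable_continuous; exact.
have ce (t : R) : {for t, continuous (fun t : R => expR (- (r * t)))}.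
  apply: continuous_comp; last exact: continuous_expR.
  by apply: cvgN; apply: cvgM; [exact: cvg_cst|exact: cvg_id].
rewrite (@ge0_continuous_FTC2y _ _ F _ 0)//.
- by rewrite -EFinB /F /GRing.scale/=; congr EFin; rewrite mulNr sub0r opprK mulrC.
- by apply: continuous_in_subspaceT => t _; exact: ce.
- rewrite -(scaler0 _ (- r^-1)); apply: cvgZr.
  apply: (cvg_comp (fun t : R => r * t) (fun t => expR (- t)) _ (@cvgr_expR R)).
  exact: gt0_cvgMry.
- by apply: cvg_at_right_filter; exact: cF.
- by move=> t _; rewrite derive1E; have [_ ->] := dF t.
Qed.

(** On ]0, 1], e^(-t) >= 1 - t, and the integral of t^(s-1) (1 - t) is 1/s - 1/(s+1). The
    intermediate inequality is additive, as [egamma s] might still be infinite. *)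
Lemma egamma_lower s : 0 < s -> ((s * (s + 1))^-1%:E <= egamma s)%E.
Proof.
move=> s0; have s1 : 0 < s + 1 by rewrite addr_gt0.
have mp r D : measurable_fun D (fun t : measurableTypeR R => (t `^ r)%:E).
  by apply/measurable_EFinP; apply: measurable_funTS; exact: measurable_powR.
have p0 r (t : R) : (0%:E <= (t `^ r)%:E)%E by rewrite lee_fin powR_ge0.
have [mg g0] := kernel_gamma_kernel s.
have mgT : measurable_fun (`]0, 1]%classic : set (measurableTypeR R)) (EFin \o gamma_kernel s) by exact: measurable_funTS.
have h : (s^-1%:E <= egamma s + (s + 1)^-1%:E)%E.
  rewrite -!integral_power01// addrK.
  apply: (@le_trans _ _ (\int[mu]_(t in `]0%R, 1%R]) (gamma_kernel s t)%:E +
     \int[mu]_(t in `]0%R, 1%R]) (t `^ s)%:E)%E).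
    rewrite -ge0_integralD//; last by move=> t _; exact: g0.
    apply: ge0_le_integral => //.
    - by apply: emeasurable_funD.
    - move=> t /=; rewrite in_itv/= => /andP[t0 _]; rewrite -EFinD lee_fin.
      rewrite gamma_kernelE// -(mulr_powRB1 (ltW t0) s0) -[leLHS]mul1r.
      rewrite (mulrC (t `^ _) (expR _)) -mulrDl ler_wpM2r ?powR_ge0//.
      by have := expR_ge1Dx (- t); lra.
  by apply: leeD => //; apply: ge0_subset_integral => // t _; exact: g0.
apply: (@le_trans _ _ (s^-1%:E - (s + 1)^-1%:E)%E); last by rewrite leeBlDr.
rewrite -EFinB lee_fin le_eqVlt; apply/orP; left; apply/eqP; field.
by rewrite !gt_eqF.
Qed.

(** The integrand is at most t^(s-1) on ]0, 1] and, as s <= 1, at most e^(-t) beyond, where the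
    integral is e^(-1) <= 1. *)
Lemma egamma_upper s : 0 < s -> s <= 1 -> (egamma s <= (s^-1 + 1)%:E)%E.
Proof.
move=> s0 s1.
have mp r : measurable_fun setT (fun t : measurableTypeR R => (t `^ r)%:E).
  by apply/measurable_EFinP; apply: measurable_funTS; exact: measurable_powR.
have me : measurable_fun setT (fun t : measurableTypeR R => (expR (- (1 * t)))%:E).
  apply/measurable_EFinP; apply: (measurableT_comp (@measurable_expR R)).
  by apply: measurable_funN; exact: measurable_funM.
have [mg g0] := kernel_gamma_kernel s.
apply: (@le_trans _ _ (\int[mu]_(t in `]0%R, 1%R]) (t `^ (s - 1))%:E +
    \int[mu]_(t in `[1%R, +oo[) (expR (- (1 * t)))%:E)%E); last first.
  rewrite integral_power01// integral_expR_tail// -EFinD lee_fin lerD2l.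
  by rewrite divr1 -[leRHS]expR0 ler_expR; lra.
rewrite integral_mkcond [X in (_ + X)%E]integral_mkcond -ge0_integralD//.
- apply: ge0_le_integral => //.
  + by move=> t _; exact: g0.
  + apply: emeasurable_funD; apply/(measurable_restrictT _ (measurable_itv _)); apply: measurable_funTS; first [exact: mp|exact: me].
  + move=> t _; rewrite !patchE -[point]/(0 : \bar R)%E !mem_setE !in_itv/= andbT.
    have [t0|t0] := leP t 0.
      rewrite /gamma_kernel ltNge t0/= add0e; case: ifP => // _;
        by rewrite lee_fin ?powR_ge0 ?expR_ge0.
    rewrite gamma_kernelE//; have [t1|t1] := leP t 1.
      apply: (@le_trans _ _ (t `^ (s - 1))%:E).
        by rewrite lee_fin ler_piMr ?powR_ge0// -expR0 ler_expR oppr_le0 ltW.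
      by rewrite leeDl//; case: ifP => // _; rewrite lee_fin expR_ge0.
    rewrite (ltW t1) add0e lee_fin mul1r ler_piMl ?expR_ge0//.
    rewrite -[leRHS](powRr0 t); apply: ler_powR; first exact: ltW.
    by rewrite subr_le0.
- by move=> t _; rewrite patchE; case: ifP => //; rewrite lee_fin powR_ge0.
- by apply/(measurable_restrictT _ (measurable_itv _)); apply: measurable_funTS; first [exact: mp|exact: me].
- by move=> t _; rewrite patchE; case: ifP => //; rewrite lee_fin expR_ge0.
- by apply/(measurable_restrictT _ (measurable_itv _)); apply: measurable_funTS; first [exact: mp|exact: me].
Qed.

End GammaKernel.

Section GammaSemigroup.
Context {R : realType}.
Notation mu := (@lebesgue_measure R).
Implicit Types s r h t x : R.
Local Open Scope ereal_scope.

Lemma gamma_kernel_le0 s t : (t <= 0)%R -> gamma_kernel s t = 0%R.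
Proof. by move=> t0; rewrite /gamma_kernel ltNge t0. Qed.

Definition beta_kernel r h v : R := (gamma_kernel r v * gamma_kernel h (1 - v))%R.

(* The factor e compensates the exponentials in gamma_kernel r v and
   gamma_kernel h (1 - v), whose product is 1 / e. *)
Definition ebeta r h : \bar R := expeR 1 * \int[mu]_v (beta_kernel r h v)%:E.

Let measurable_conv_kernel r h x :
  measurable_fun setT (fun y : measurableTypeR R =>
    (gamma_kernel r y)%:E * (gamma_kernel h (x - y))%:E).
Proof.
have [mr _] := kernel_gamma_kernel r; have [mh _] := kernel_gamma_kernel h.
apply: emeasurable_funM => //; apply: (measurableT_comp mh).
exact: measurable_funB.
Qed.

Lemma measurable_beta_kernel r h :
  measurable_fun setT (fun v => (beta_kernel r h v)%:E).
Proof.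
by have := measurable_conv_kernel r h 1; apply: eq_measurable_fun => v _; rewrite -EFinM.
Qed.

Lemma ebeta_ge0 r h : 0 <= ebeta r h.
Proof.
apply: mule_ge0; first by rewrite lee_fin expR_ge0.
by apply: integral_ge0 => v _; rewrite lee_fin mulr_ge0// gamma_kernel_ge0.
Qed.

(** The substitution y = x v pulls out x^(r+h-1) e^(-x) and leaves a Beta integral independent of x.
    This is the semigroup law up to normalisation. *)
Lemma convolution_gamma_kernel r h x :
  convolution (EFin \o gamma_kernel r) (EFin \o gamma_kernel h) x =
  ebeta r h * (gamma_kernel (r + h) x)%:E.
Proof.
have [x0|x0] := leP x 0%R.
  rewrite (gamma_kernel_le0 _ x0) mule0 /convolution integral0_eq// => y _ /=.
  have [y0|y0] := leP y 0%R; first by rewrite gamma_kernel_le0// mul0e.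
  by rewrite (@gamma_kernel_le0 h) ?mule0//; lra.
rewrite /convolution (@ge0_integral_affine _ x 0); last 3 first.
- by rewrite gt_eqF.
- exact: measurable_conv_kernel.
- by move=> y; rewrite mule_ge0// lee_fin gamma_kernel_ge0.
(* The exponents r - 1 and h - 1 of x add up to r + h - 2, the Jacobian x being kept apart; the
   final 1 offsets the factor e^(-1) contained in [beta_kernel]. *)
pose C : R := expR ((r + h - 2) * ln x - x + 1).
rewrite (_ : \int[mu]_y _ = C%:E * \int[mu]_v (beta_kernel r h v)%:E); last first.
  rewrite -ge0_integralZl//; last 3 first.
  - exact: measurable_beta_kernel.
  - by move=> v _; rewrite lee_fin mulr_ge0// gamma_kernel_ge0.
  - by rewrite lee_fin expR_ge0.
  apply: eq_integral => v _ /=; rewrite addr0 -!EFinM; congr EFin.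
  rewrite /beta_kernel /gamma_kernel pmulr_rgt0//.
  rewrite (_ : x - x * v = x * (1 - v))%R; last by ring.
  rewrite pmulr_rgt0//; have [v0|v0] := ltP 0%R v; last by rewrite !mul0r mulr0.
  have [v1|v1] := ltP 0%R (1 - v)%R; last by rewrite !mulr0.
  by rewrite -!expRD !lnM ?posrE//; congr expR; ring.
rewrite /ebeta muleA -EFinM [RHS]muleC muleA; congr (_ * _).
rewrite /gamma_kernel x0 gtr0_norm//= -EFinM; congr EFin.
rewrite -{1}(lnK x0) -!expRD; congr expR; ring.
Qed.

(** Euler's relation between Beta and Gamma, read off by integrating the preceding identity in x. It
    fixes the constant in the semigroup law. *)
Lemma egamma_mul r h : egamma r * egamma h = ebeta r h * egamma (r + h).
Proof.
have [kr kh] := (kernel_gamma_kernel r, kernel_gamma_kernel h).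
rewrite -(integral_convolution kr kh).
under eq_integral do rewrite convolution_gamma_kernel.
rewrite ge0_integralZl//.
- by have [] := kernel_gamma_kernel (r + h).
- by move=> x _; rewrite lee_fin gamma_kernel_ge0.
- exact: ebeta_ge0.
Qed.

Lemma egamma_gt0 s : (0 < s)%R -> 0 < egamma s.
Proof.
move=> s0; apply: lt_le_trans (egamma_lower s0).
by rewrite lte_fin invr_gt0 mulr_gt0// addr_gt0.
Qed.

(** [egamma_upper] settles s <= 1 and doubling gives the rest: the square of [egamma (s / 2)],
    finite and positive, equals [ebeta] times [egamma s], which excludes an infinite [egamma s]
    whether [ebeta] is zero or positive. *)
Lemma egamma_fin_num s : (0 < s)%R -> egamma s \is a fin_num.
Proof.
suff H n : forall s, (0 < s)%R -> (s <= n.+1%:R)%R -> egamma s < +oo.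
  move=> s0; rewrite ge0_fin_numE; last exact/ltW/egamma_gt0.
  apply: (H (Num.truncn s)) => //; exact/ltW/truncnS_gt.
elim: n => [|n ih] {}s s0 sn.
  by apply: le_lt_trans (egamma_upper s0 sn) _; rewrite ltry.
have s20 : (0 < s / 2)%R by rewrite divr_gt0.
have : egamma (s / 2) < +oo.
  apply: ih => //; rewrite ler_pdivrMr//; apply: (le_trans sn).
  by rewrite -natrM ler_nat muln2 -addnn addSnnS leq_addl.
move=> fin; have := egamma_mul (s / 2) (s / 2); rewrite -splitr.
have := egamma_gt0 s20; have := egamma_gt0 s0.
move: (egamma s) (egamma (s / 2)) fin (ebeta_ge0 (s / 2) (s / 2)) => a b.
move: (ebeta _ _) => c + c0 a0 b0; rewrite -ge0_fin_numE ?(ltW b0)// => bfin E.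
rewrite ltey; apply/eqP => ay; move: E; rewrite ay.
move: c0; rewrite le_eqVlt => /predU1P[<-|c0].
  by rewrite mul0e => /eqP; rewrite mule_eq0 orbb gt_eqF.
by rewrite gt0_muley// -(fineK bfin) -EFinM.
Qed.

End GammaSemigroup.

Section GammaDensity.
Context {R : realType}.
Notation mu := (@lebesgue_measure R).
Implicit Types s r h t x : R.
Local Open Scope ereal_scope.

Lemma Gamma_egamma s : (0 < s)%R -> (Gamma s)%:E = egamma s.
Proof. by move=> s0; rewrite GammaE fineK// egamma_fin_num. Qed.

Lemma Gamma_gt0 s : (0 < s)%R -> (0 < Gamma s)%R.
Proof. by move=> s0; rewrite -lte_fin Gamma_egamma// egamma_gt0. Qed.

Lemma measurable_Gamma : measurable_fun setT (@Gamma R).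
Proof.
have -> : @Gamma R = fine \o @egamma R by apply/funext => s /=; rewrite GammaE.
apply: measurableT_comp => //.
apply: (@measurable_fun_fubini_tonelli_F _ _ _ _ _ mu
  (fun z : R * R => (gamma_kernel z.1 z.2)%:E)).
  by apply/measurable_EFinP; exact: measurable_gamma_kernel2.
by move=> z; rewrite lee_fin gamma_kernel_ge0.
Qed.

(* The density at t of the Gamma distribution with shape s; the power -1 stands
   for the inverse because powers are known to be measurable. *)
Definition gamma_density s t : R :=
  if (0 < s)%R then (gamma_kernel s t * (Gamma s) `^ (- 1))%R else 0%R.

Lemma gamma_densityE s t : (0 < s)%R ->
  gamma_density s t = (gamma_kernel s t / Gamma s)%R.
Proof.
by move=> s0; rewrite /gamma_density s0 powR_inv1// ltW// Gamma_gt0.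
Qed.

Lemma gamma_density_ge0 s t : (0 <= gamma_density s t)%R.
Proof.
rewrite /gamma_density; case: ifP => // _.
by rewrite mulr_ge0 ?gamma_kernel_ge0 ?powR_ge0.
Qed.

Lemma gamma_density_le0 s t : (t <= 0)%R -> gamma_density s t = 0%R.
Proof.
by move=> t0; rewrite /gamma_density gamma_kernel_le0// mul0r; case: ifP.
Qed.

Lemma measurable_gamma_density2 :
  measurable_fun setT (fun z : R * R => gamma_density z.1 z.2).
Proof.
apply: measurable_fun_ifT => //=; first exact: measurable_fun_ltr.
apply: measurable_funM; first exact: measurable_gamma_kernel2.
apply: (measurableT_comp (measurable_powR _)).
exact: (measurableT_comp measurable_Gamma).
Qed.

Lemma measurable_egamma_density2 :
  measurable_fun setT (fun z : R * R => (gamma_density z.1 z.2)%:E).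
Proof. apply/measurable_EFinP; exact: measurable_gamma_density2. Qed.

Lemma kernel_gamma_density s : kernel (EFin \o gamma_density s).
Proof.
split; last by move=> t; rewrite lee_fin gamma_density_ge0.
exact: measurable_fun_pair2 measurable_egamma_density2.
Qed.

Lemma gamma_densityP s : (0 < s)%R -> exists A : R, [/\ (0 < A)%R,
  egamma s = A%:E & forall t, gamma_density s t = (gamma_kernel s t / A)%R].
Proof.
move=> s0; exists (Gamma s); split; first exact: Gamma_gt0.
  by rewrite Gamma_egamma.
by move=> t; exact: gamma_densityE.
Qed.

Lemma integral_gamma_density s : (0 < s)%R ->
  \int[mu]_t (gamma_density s t)%:E = 1.
Proof.
move=> s0; have [A [A0 AE dA]] := gamma_densityP s0.
under eq_integral do rewrite dA mulrC EFinM.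
have [mk k0] := kernel_gamma_kernel s.
rewrite ge0_integralZl//; last 2 first.
- by move=> t _; exact: k0.
- by rewrite lee_fin invr_ge0 ltW.
by rewrite -[X in _ * X]/(egamma s) AE -EFinM mulVf// gt_eqF.
Qed.

Lemma convolution_gamma_density r h x : (0 < r)%R -> (0 < h)%R ->
  convolution (EFin \o gamma_density r) (EFin \o gamma_density h) x =
  (gamma_density (r + h) x)%:E.
Proof.
move=> r0 h0; have [A [A0 AE dA]] := gamma_densityP r0.
have [B [B0 BE dB]] := gamma_densityP h0.
have [C [C0 CE dC]] := gamma_densityP (addr_gt0 r0 h0).
have [kr kh] := (kernel_gamma_kernel r, kernel_gamma_kernel h).
transitivity ((A^-1 * B^-1)%:E *
    convolution (EFin \o gamma_kernel r) (EFin \o gamma_kernel h) x).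
  rewrite /convolution -ge0_integralZl//.
  - apply: eq_integral => y _ /=; rewrite dA dB -!EFinM.
    by congr EFin; rewrite mulrACA [RHS]mulrC.
  - apply: emeasurable_funM => //; first by case: kr.
    by apply: (measurableT_comp kh.1); exact: measurable_funB.
  - by move=> y _; apply: mule_ge0; [exact: kr.2|exact: kh.2].
  - by rewrite lee_fin mulr_ge0// invr_ge0 ltW.
rewrite convolution_gamma_kernel dC.
have := egamma_mul r h; rewrite AE BE CE.
case: (ebeta r h) (ebeta_ge0 r h) => [b| |//] b0; last first.
  by rewrite gt0_mulye ?lte_fin.
rewrite -!EFinM => -[E]; congr EFin.
have -> : b = (A * B / C)%R by rewrite E mulfK// gt_eqF.
by move: (gamma_kernel _ _) => G; field; rewrite !gt_eqF.
Qed.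

End GammaDensity.

(** * The Sonine identity *)

Section Tails.
Context {R : realType}.
Notation mu := (@lebesgue_measure R).
Implicit Types (f g : R -> \bar R) (x T : R).
Local Open Scope ereal_scope.

Definition heaviside x : \bar R := if (0 < x)%R then 1 else 0.

Lemma heaviside_ge0 x : 0 <= heaviside x.
Proof. by rewrite /heaviside; case: ifP. Qed.

Lemma kernel_heaviside : kernel heaviside.
Proof.
split; last exact: heaviside_ge0.
by apply: measurable_fun_ifT => //=; exact: measurable_fun_ltr.
Qed.

(** The guard 0 < x makes the tail vanish for x <= 0, where the plain tail would not: it is again a
    kernel of the half-line. *)
Definition tail f x := \int[mu]_y (if (0 < x <= y)%R then f y else 0).

Lemma kernel_tail f : kernel f -> kernel (tail f).
Proof.
move=> [mf f0]; split; last by move=> x; apply: integral_ge0 => y _; case: ifP.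
apply: (@measurable_fun_fubini_tonelli_F _ _ _ _ _ mu
  (fun z : R * R => if (0 < z.1 <= z.2)%R then f z.2 else 0)); last first.
  by move=> z; case: ifP.
apply: measurable_fun_ifT => //=; last exact: measurableT_comp mf _.
by apply: measurable_and; [exact: measurable_fun_ltr|exact: measurable_fun_ler].
Qed.

Lemma convolution_heaviside f T : kernel f ->
  convolution f heaviside T = \int[mu]_(y in `]-oo, T[) f y.
Proof.
move=> [mf f0]; rewrite [RHS]integral_mkcond; apply: eq_integral => y _.
rewrite patchE mem_setE in_itv/= /heaviside subr_gt0.
by case: ifP; rewrite ?mule1 ?mule0.
Qed.

Lemma tail_heaviside f x : kernel f -> (forall y, (y <= 0)%R -> f y = 0) ->
  tail f x + convolution f heaviside x = (\int[mu]_y f y) * heaviside x.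
Proof.
move=> [mf f0] fneg; rewrite convolution_heaviside// integral_mkcond.
have mpatch : measurable_fun setT (f \_ `]-oo, x[).
  by apply/(measurable_restrictT _ (measurable_itv _)); exact: measurable_funTS.
have mtail : measurable_fun setT (fun y => if (0 < x <= y)%R then f y else 0).
  apply: measurable_fun_ifT => //=.
  by apply: measurable_and => //; exact: measurable_fun_ler.
rewrite -ge0_integralD//; last 2 first.
- by move=> y _; case: ifP.
- by move=> y _; rewrite patchE; case: ifP.
rewrite -ge0_integralZr ?heaviside_ge0//; apply: eq_integral => y _ /=.
rewrite patchE -[point]/(0 : \bar R) mem_setE in_itv/= /heaviside.
have [x0|x0] /= := ltP 0%R x; last first.
  by rewrite add0e mule0; case: ifP => // yx; rewrite fneg// ltW// (lt_le_trans yx).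
by rewrite mule1; case: leP; rewrite ?adde0 ?add0e.
Qed.

End Tails.

Section Superposition.
Context {R : realType}.
Notation mu := (@lebesgue_measure R).
Implicit Types (f : R -> \bar R) (s r h t x T : R).
Local Open Scope ereal_scope.

Lemma convolutionDr f (g k : R -> \bar R) x : kernel f -> kernel g -> kernel k ->
  convolution f (g \+ k) x = convolution f g x + convolution f k x.
Proof.
move=> kf kg kk; have kgk : kernel (g \+ k).
  split; first by apply: emeasurable_funD; [exact: kg.1|exact: kk.1].
  by move=> y; apply: adde_ge0; [exact: kg.2|exact: kk.2].
by rewrite !(convolutionC kf)// convolutionDl.
Qed.

Variable K : R -> R -> R.
Hypothesis mK : measurable_fun setT (fun z : R * R => (K z.1 z.2)%:E).
Hypothesis K0 : forall s t, (0 <= K s t)%R.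
Variable D : set (measurableTypeR R).
Hypothesis mD : measurable D.

Definition superposition t := \int[mu]_(s in D) (K s t)%:E.

Let mKD : measurable_fun setT (fun z : R * R => (K z.2 z.1)%:E * (\1_D z.2)%:E).
Proof.
apply: emeasurable_funM.
  exact: measurableT_comp mK (@measurable_swap _ _ _ _).
apply/measurable_EFinP; apply: measurableT_comp => //.
Qed.

Let KD0 s t : 0 <= (K s t)%:E * (\1_D s)%:E.
Proof. by rewrite mule_ge0 ?lee_fin. Qed.

Let superpositionE t : superposition t = \int[mu]_s ((K s t)%:E * (\1_D s)%:E).
Proof.
rewrite /superposition integral_mkcond; apply: eq_integral => s _.
by rewrite patchE indicE; case: ifP; rewrite ?mule1 ?mule0.
Qed.

Lemma kernel_superposition : kernel superposition.
Proof.
split; last by move=> t; apply: integral_ge0 => s _; rewrite lee_fin.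
have -> : superposition = fun t => \int[mu]_s ((K s t)%:E * (\1_D s)%:E).
  by apply/funext => t; exact: superpositionE.
exact: (@measurable_fun_fubini_tonelli_F _ _ _ _ _ mu
  (fun z : R * R => (K z.2 z.1)%:E * (\1_D z.2)%:E)).
Qed.

Lemma convolution_superposition f x : kernel f ->
  convolution superposition f x =
  \int[mu]_(s in D) convolution (EFin \o K s) f x.
Proof.
move=> [mf f0].
transitivity (\int[mu]_y \int[mu]_s ((K s y)%:E * (\1_D s)%:E * f (x - y)%R)).
  apply: eq_integral => y _; rewrite superpositionE ge0_integralZr//.
  exact: measurable_fun_pair2 mKD.
rewrite (@fubini_tonelli _ _ _ _ _ mu mu
  (fun z : R * R => (K z.2 z.1)%:E * (\1_D z.2)%:E * f (x - z.1)%R)); last 2 first.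
- apply: emeasurable_funM => //; apply: (measurableT_comp mf).
  exact: measurable_funB.
- by move=> z; rewrite mule_ge0.
rewrite [RHS]integral_mkcond; apply: eq_integral => s _ /=.
rewrite patchE; case: ifPn => sD.
  by apply: eq_integral => y _; rewrite indicE sD mule1.
rewrite integral0_eq// => y _; by rewrite indicE (negPf sD) mule0 mul0e.
Qed.

End Superposition.

(* The potential of a convolution semigroup of probability densities K s on the
   half-line (K s = 0 for s <= 0 is a convention). *)
Section ConvolutionSemigroup.
Context {R : realType}.
Notation mu := (@lebesgue_measure R).
Implicit Types (f : R -> \bar R) (s r h t x T : R).
Local Open Scope ereal_scope.

Variable K : R -> R -> R.
Hypothesis mK : measurable_fun setT (fun z : R * R => (K z.1 z.2)%:E).
Hypothesis K0 : forall s t, (0 <= K s t)%R.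
Hypothesis Kneg : forall s t, (s <= 0)%R -> K s t = 0%R.
Hypothesis Ksupp : forall s t, (t <= 0)%R -> K s t = 0%R.
Hypothesis K1 : forall s, (0 < s)%R -> \int[mu]_t (K s t)%:E = 1.
Hypothesis Ksemi : forall r h x, (0 < r)%R -> (0 < h)%R ->
  convolution (EFin \o K r) (EFin \o K h) x = (K (r + h) x)%:E.

Let potential := superposition K setT.

Let kK s : kernel (EFin \o K s).
Proof.
split; last by move=> t; rewrite lee_fin.
exact: measurable_fun_pair2 mK.
Qed.

(** For s > h the semigroup law writes K s as K (s - h) convolved with K h. Shifting s by h turns
    this part into the whole potential convolved with K h. *)
Lemma potential_split h t : (0 < h)%R ->
  potential t = superposition K `]-oo, h] t + convolution potential (EFin \o K h) t.
Proof.
move=> h0; have mgt : measurable_fun setT (fun s => (K s t)%:E).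
  exact: measurable_fun_pair1 mK.
rewrite /potential convolution_superposition//.
rewrite /superposition -(setUv (`]-oo, h]%classic)) ge0_integral_setU//=; last 4 first.
- exact: measurableC.
- by rewrite setUv.
- by move=> s _; rewrite lee_fin.
- exact/disj_setPCl.
congr (_ + _); rewrite setUv setCitvl integral_mkcond.
rewrite -(ge0_integral_translate (- h)); last 2 first.
- apply/(measurable_restrictT _ (measurable_itv _)); exact: measurable_funTS.
- by move=> s; rewrite patchE; case: ifP => // _; rewrite lee_fin.
apply: eq_integral => s _; rewrite patchE mem_setE in_itv/= andbT opprK.
rewrite -subr_gt0 addrK; case: ifPn => [s0|]; first by rewrite Ksemi.
rewrite -leNgt => s0; rewrite /convolution integral0_eq// => y _ /=.
by rewrite Kneg// mul0e.
Qed.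

Let tailE s x : (0 < s)%R ->
  tail (EFin \o K s) x + convolution (EFin \o K s) heaviside x = heaviside x.
Proof.
move=> s0; rewrite tail_heaviside//; first by rewrite K1// mul1e.
by move=> y y0; rewrite /= Ksupp.
Qed.

(** With U the potential, A its part s <= h and 1 the Heaviside function, U = A + U * K_h and 1 =
    tail K_h + K_h * 1. Both expansions of U * 1 contain U * K_h * 1, which cancels because U * 1 is
    finite at T. *)
Lemma potential_tail h T : (0 < h)%R -> convolution potential heaviside T < +oo ->
  convolution potential (tail (EFin \o K h)) T =
  convolution (superposition K `]-oo, h]) heaviside T.
Proof.
move=> h0 fin; have kp : kernel potential by exact: kernel_superposition.
have kA : kernel (superposition K `]-oo, h]) by exact: kernel_superposition.
have kH := @kernel_heaviside R.
set A := superposition K _ in kA *.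
have kt : kernel (tail (EFin \o K h)) := kernel_tail (kK h).
have kc := kernel_convolution kp (kK h).
have kc' := kernel_convolution (kK h) kH.
have E1 : potential = A \+ convolution potential (EFin \o K h).
  by apply/funext => t; rewrite [LHS](potential_split _ h0).
have E2 : heaviside = tail (EFin \o K h) \+ convolution (EFin \o K h) heaviside.
  by apply/funext => t; rewrite -[LHS](tailE _ h0).
have e1 : convolution potential heaviside T = convolution A heaviside T +
    convolution (convolution potential (EFin \o K h)) heaviside T.
  by rewrite {1}E1 convolutionDl.
have e2 : convolution potential heaviside T =
    convolution potential (tail (EFin \o K h)) T +
    convolution potential (convolution (EFin \o K h) heaviside) T.
  by rewrite {1}E2 convolutionDr.
rewrite convolutionA// in e1.
have cfin : convolution potential (convolution (EFin \o K h) heaviside) T \is a fin_num.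
  rewrite ge0_fin_numE ?convolution_ge0//; apply: le_lt_trans fin.
  by rewrite e2 leeDr// convolution_ge0.
by rewrite -[LHS](addeK _ cfin) -e2 e1 addeK.
Qed.

Let convolution_superposition_itv h T : (0 < h)%R ->
  convolution (superposition K `]-oo, h]) heaviside T =
  \int[mu]_(s in `]0%R, h]) convolution (EFin \o K s) heaviside T.
Proof.
move=> h0; rewrite convolution_superposition//; last exact: kernel_heaviside.
rewrite integral_mkcond [RHS]integral_mkcond; apply: eq_integral => s _.
rewrite !patchE !mem_setE !in_itv/=; have [s0/=|s0//=] := leP s 0%R.
case: ifP => // _; rewrite /convolution integral0_eq// => y _ /=.
by rewrite Kneg// mul0e.
Qed.

Let measurable_conv T : measurable_fun setT
  (fun s => convolution (EFin \o K s) heaviside T).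
Proof.
apply: (@measurable_fun_fubini_tonelli_F _ _ _ _ _ mu
  (fun z : R * R => (K z.1 z.2)%:E * heaviside (T - z.2)%R)).
  apply: emeasurable_funM => //.
  by apply: (measurableT_comp kernel_heaviside.1); exact: measurable_funB.
by move=> z; apply: mule_ge0; rewrite ?lee_fin ?heaviside_ge0.
Qed.

Lemma potential_tail_upper h T : (0 < h)%R -> convolution potential heaviside T < +oo ->
  convolution potential (tail (EFin \o K h)) T <= h%:E.
Proof.
move=> h0 fin; rewrite potential_tail// convolution_superposition_itv//.
apply: (@le_trans _ _ (\int[mu]_(s in `]0%R, h]) cst 1 s)); last first.
  by rewrite integral_cst// [X in _ * X]lebesgue_measure_itv/= lte_fin h0 sube0 mul1e.
apply: ge0_le_integral => //.
- by move=> s _; apply: convolution_ge0 => //; exact: kernel_heaviside.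
- by apply: measurable_funTS; exact: measurable_conv.
- move=> s; rewrite /= in_itv/= => /andP[s0 _].
  apply: (@le_trans _ _ (heaviside T)).
    by rewrite -(tailE T s0) leeDr// (kernel_tail (kK s)).2.
  by rewrite /heaviside; case: ifP.
Qed.

(** The probability P(X_s <= T) is 1 minus a tail, hence at least 1 - C s >= 1 - C h. Integrating
    over 0 < s <= h loses at most C h^2. *)
Lemma potential_tail_lower h T (C : R) : (0 < h)%R -> (0 < T)%R -> (0 <= C)%R ->
  convolution potential heaviside T < +oo ->
  (forall s, (0 < s)%R -> (s <= h)%R -> tail (EFin \o K s) T <= (C * s)%:E) ->
  h%:E <= convolution potential (tail (EFin \o K h)) T + (C * h ^+ 2)%:E.
Proof.
move=> h0 T0 C0 fin tailC; rewrite potential_tail// convolution_superposition_itv//.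
have muh : mu `]0%R, h]%classic = h%:E.
  by rewrite lebesgue_measure_itv/= lte_fin h0 sube0.
have Ch0 : (0 <= C * h)%R by rewrite mulr_ge0// ltW.
have -> : (C * h ^+ 2)%:E = \int[mu]_(s in `]0%R, h]) cst (C * h)%:E s.
  by rewrite integral_cst// [X in _ * X]muh -EFinM expr2 mulrA.
have {1}-> : h%:E = \int[mu]_(s in `]0%R, h]) cst 1 s.
  by rewrite integral_cst// [X in _ * X]muh mul1e.
rewrite -ge0_integralD//; last 2 first.
- by move=> s _; apply: convolution_ge0 => //; exact: kernel_heaviside.
- by apply: measurable_funTS; exact: measurable_conv.
apply: ge0_le_integral => //.
- by apply: emeasurable_funD => //; apply: measurable_funTS; exact: measurable_conv.
- move=> s; rewrite /= in_itv/= => /andP[s0 sh].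
  have -> : 1 = heaviside T by rewrite /heaviside T0.
  rewrite -(tailE T s0) addeC leeD2l//.
  apply: (le_trans (tailC _ s0 sh)); rewrite lee_fin.
  by rewrite ler_wpM2l.
Qed.

End ConvolutionSemigroup.

(** * Bounds on the tails of the Gamma densities *)

Section TailsOfGammaDensities.
Context {R : realType}.
Notation mu := (@lebesgue_measure R).
Implicit Types (f g : R -> \bar R) (s r h t x y T : R).
Local Open Scope ereal_scope.

Let measurable_tail_integrand f x : kernel f ->
  measurable_fun setT (fun y => if (0 < x <= y)%R then f y else 0).
Proof.
move=> [mf _]; apply: measurable_fun_ifT => //=.
by apply: measurable_and => //; exact: measurable_fun_ler.
Qed.

Lemma le_tail f g x : kernel f -> kernel g ->
  ((0 < x)%R -> forall y, (x <= y)%R -> f y <= g y) -> tail f x <= tail g x.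
Proof.
move=> kf kg fg; apply: ge0_le_integral => //.
- by move=> y _; case: ifP => // _; exact: kf.2.
- exact: measurable_tail_integrand.
- exact: measurable_tail_integrand.
- by move=> y _; case: ifP => // /andP[x0 xy]; exact: fg.
Qed.

Lemma tailZ (c : R) f x : (0 <= c)%R -> kernel f ->
  tail (fun y => c%:E * f y) x = c%:E * tail f x.
Proof.
move=> c0 kf; rewrite /tail -ge0_integralZl//.
- by apply: eq_integral => y _; case: ifP; rewrite ?mule0.
- exact: measurable_tail_integrand.
- by move=> y _; case: ifP => // _; exact: kf.2.
Qed.

Lemma tailD f g x : kernel f -> kernel g ->
  tail (f \+ g) x = tail f x + tail g x.
Proof.
move=> kf kg; rewrite /tail -ge0_integralD//.
- by apply: eq_integral => y _; case: ifP; rewrite ?adde0.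
- by move=> y _; case: ifP => // _; exact: kf.2.
- exact: measurable_tail_integrand.
- by move=> y _; case: ifP => // _; exact: kg.2.
- exact: measurable_tail_integrand.
Qed.

Lemma kernelZ (c : R) f : (0 <= c)%R -> kernel f -> kernel (fun y => c%:E * f y).
Proof.
move=> c0 kf; split; last by move=> y; apply: mule_ge0; rewrite ?lee_fin ?kf.2.
by apply: emeasurable_funM => //; exact: kf.1.
Qed.

Lemma kernelD f g : kernel f -> kernel g -> kernel (f \+ g).
Proof.
move=> kf kg; split; first by apply: emeasurable_funD; [exact: kf.1|exact: kg.1].
by move=> y; apply: adde_ge0; [exact: kf.2|exact: kg.2].
Qed.

Lemma convolutionZr (c : R) f g x : (0 <= c)%R -> kernel f -> kernel g ->
  convolution f (fun y => c%:E * g y) x = c%:E * convolution f g x.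
Proof.
move=> c0 kf kg; rewrite /convolution -ge0_integralZl//.
- by apply: eq_integral => y _; rewrite muleCA.
- apply: emeasurable_funM; first exact: kf.1.
  by apply: (measurableT_comp kg.1); exact: measurable_funB.
- by move=> y _; apply: mule_ge0; [exact: kf.2|exact: kg.2].
Qed.

Definition exp_kernel (y : R) : \bar R := (expR (- (1 * y)))%:E.

Lemma kernel_exp_kernel : kernel exp_kernel.
Proof.
split; last by move=> y; rewrite lee_fin expR_ge0.
apply/measurable_EFinP; apply: (measurableT_comp (@measurable_expR R)).
by apply: measurable_funN; exact: measurable_funM.
Qed.

Lemma tail_exp_kernel x : tail exp_kernel x <= heaviside x.
Proof.
rewrite /tail /heaviside; case: ltP => x0 /=; last by rewrite integral0.
apply: (@le_trans _ _ (\int[mu]_(y in `[x, +oo[) exp_kernel y)).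
  rewrite le_eqVlt; apply/orP; left; apply/eqP.
  rewrite [RHS]integral_mkcond; apply: eq_integral => y _.
  by rewrite patchE mem_setE in_itv/= andbT.
rewrite integral_expR_tail// lee_fin divr1 -[leRHS]expR0 ler_expR; lra.
Qed.

(** [A] is Gamma(s), and the bounds read 1 / (1 + s) <= s Gamma(s) <= 1 + s. Dividing a tail by s
    thus amounts, as s tends to 0, to removing the factor 1 / Gamma(s). *)
Lemma tail_gamma_density s : (0 < s)%R -> (s <= 1)%R -> exists A : R,
  [/\ (0 < A)%R, (1 <= A * s * (1 + s))%R, (A * s <= 1 + s)%R &
      forall x, tail (EFin \o gamma_density s) x =
        A^-1%:E * tail (EFin \o gamma_kernel s) x].
Proof.
move=> s0 s1; have [A [A0 AE dA]] := gamma_densityP s0.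
have := egamma_lower s0; have := egamma_upper s0 s1; rewrite AE !lee_fin => Au Al.
exists A; split => //.
- move: Al; rewrite -[X in (X <= _)%R]mul1r ler_pdivrMr ?mulr_gt0 ?addr_gt0//.
  by rewrite mulrA (addrC 1%R).
- have := ler_wpM2r (ltW s0) Au; rewrite mulrDl mulVf ?gt_eqF// mul1r.
  exact.
- move=> x; rewrite -tailZ ?invr_ge0 ?(ltW A0)//; last exact: kernel_gamma_kernel.
  by apply: eq_integral => y _; rewrite /= dA mulrC EFinM.
Qed.

(** For y >= T and s <= 1, y^(s-1) <= T^(s-1) <= e^|ln T|, and 1 / Gamma(s) <= s (1 + s) <= 2 s. *)
Lemma tail_gamma_density_le s T : (0 < s)%R -> (s <= 1)%R -> (0 < T)%R ->
  tail (EFin \o gamma_density s) T <= (2 * expR `|ln T| * s)%:E.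
Proof.
move=> s0 s1 T0; have [A [A0 Al _ ->]] := tail_gamma_density s0 s1.
have kE : kernel (fun y => (expR `|ln T|)%:E * exp_kernel y).
  by apply: kernelZ; [exact: expR_ge0|exact: kernel_exp_kernel].
apply: (@le_trans _ _ (A^-1%:E * (expR `|ln T|)%:E)).
  apply: lee_wpmul2l; first by rewrite lee_fin invr_ge0 ltW.
  apply: (@le_trans _ _ (tail (fun y => (expR `|ln T|)%:E * exp_kernel y) T)).
    apply: le_tail => //; first exact: kernel_gamma_kernel.
    move=> _ y Ty; have y0 := lt_le_trans T0 Ty.
    rewrite /= /gamma_kernel y0 -EFinM -expRD lee_fin ler_expR mul1r lerD2r.
    have l1 : (ln T <= ln y)%R by rewrite ler_ln.
    have l2 : ((s - 1) * ln y <= (s - 1) * ln T)%R by rewrite ler_wnM2l// subr_le0.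
    have l3 : ((1 - s) * - ln T <= (1 - s) * `|ln T|)%R.
      by rewrite ler_wpM2l ?subr_ge0// -normrN ler_norm.
    have l4 : ((1 - s) * `|ln T| <= `|ln T|)%R.
      by rewrite ler_piMl//; lra.
    lra.
  rewrite tailZ ?expR_ge0//; last exact: kernel_exp_kernel.
  rewrite -[leRHS]mule1 lee_wpmul2l ?lee_fin ?expR_ge0//.
  by apply: (le_trans (tail_exp_kernel _)); rewrite /heaviside T0.
rewrite -EFinM lee_fin [leRHS]mulrAC ler_wpM2r ?expR_ge0//.
rewrite -[leLHS]mul1r ler_pdivrMr//; apply: (le_trans Al).
have : (A * s * (1 + s) <= A * s * 2)%R.
  by rewrite ler_wpM2l ?mulr_ge0 ?(ltW A0) ?(ltW s0)//; lra.
lra.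
Qed.

(** Weighted arithmetic-geometric inequality y^h <= h y + (1 - h), from the convexity of the
    exponential between ln y and 0. *)
Lemma expR_ln_le1D h y : (0 <= h)%R -> (h <= 1)%R -> (0 < y)%R ->
  (expR (h * ln y) <= 1 + h * y)%R.
Proof.
move=> h0 h1 y0; have := @convex_expR R (Itv01 h0 h1) (ln y) 0%R.
by rewrite !convRE/= mulr0 addr0 lnK// expR0 mulr1 => /le_trans; apply;
  change (h * y + (1 - h) <= 1 + h * y)%R; lra.
Qed.

Lemma gamma_density_neg s t : (s <= 0)%R -> gamma_density s t = 0%R.
Proof. by move=> s0; rewrite /gamma_density ltNge s0. Qed.

Let gd0 := @gamma_density_ge0 R.
Let mgd := @measurable_egamma_density2 R.

Definition potential t := superposition (@gamma_density R) setT t.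

Lemma kernel_potential : kernel potential.
Proof. exact: kernel_superposition. Qed.

(** The Laplace transform of the Gamma kernel at 1, by replacing y with 2 y. The factor 2^(-s) is
    written as an exponential in s so that [integral_expR_tail] integrates it. *)
Let gamma_kernel_half s : (0 < s)%R ->
  \int[mu]_y (expR (- y) * gamma_kernel s y)%:E =
  (expR (- (ln 2 * s)))%:E * egamma s.
Proof.
move=> s0; have [mk k0] := kernel_gamma_kernel s.
have l2 : 2%R = expR (ln 2%R) :> R by rewrite lnK// posrE.
rewrite /egamma (@ge0_integral_affine _ 2%R 0%R (EFin \o gamma_kernel s))//.
have n2 : `|2|%R = 2%R :> R by rewrite gtr0_norm.
have m2 : measurable_fun setT (fun y : R => (EFin \o gamma_kernel s) (2 * y + 0)%R).
  exact: measurableT_comp mk (@measurable_affine R 2 0).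
have c0 : 0 <= (expR (- (ln 2 * s)) * 2)%:E by rewrite lee_fin mulr_ge0// expR_ge0.
rewrite n2 muleA -EFinM -(@ge0_integralZl _ _ R mu setT measurableT _ m2 _ (fun y _ => k0 _) c0).
apply: eq_integral => y _; rewrite /= addr0 -EFinM; congr EFin.
rewrite /gamma_kernel pmulr_rgt0//; have [y0|y0] := ltP 0%R y; last by rewrite !mulr0.
by rewrite {2}l2 lnM ?posrE// -!expRD; congr expR; ring.
Qed.

(** Exponential Markov bound: [heaviside (T - y)] is at most e^(T - y), so the density of shape s
    gives y < T a mass of at most e^T 2^(-s), integrable in s. *)
Lemma potential_locally_finite T : convolution potential heaviside T < +oo.
Proof.
have kH := @kernel_heaviside R.
rewrite convolution_superposition//.
have l2 : (0 < ln 2 :> R)%R by rewrite ln_gt0// ltr1n.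
apply: (@le_lt_trans _ _ (\int[mu]_(s in `[0%R, +oo[)
   ((expR T)%:E * (expR (- (ln 2 * s)))%:E))); last first.
  rewrite ge0_integralZl//; last first.
    apply/measurable_EFinP; apply: (measurableT_comp (@measurable_expR R)).
    by apply: measurable_funN; exact: measurable_funM.
  by rewrite integral_expR_tail// -EFinM ltry.
rewrite [leRHS]integral_mkcond; apply: ge0_le_integral => //.
- by move=> s _; exact: (convolution_ge0 _ (kernel_gamma_density s) kH).
- apply: (@measurable_fun_fubini_tonelli_F _ _ _ _ _ mu
    (fun z : R * R => (gamma_density z.1 z.2)%:E * heaviside (T - z.2)%R)).
    apply: emeasurable_funM => //.
    by apply: (measurableT_comp kH.1); exact: measurable_funB.
  by move=> z; apply: mule_ge0; rewrite ?lee_fin ?heaviside_ge0.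
- apply/(measurable_restrictT _ (measurable_itv _)); apply: measurable_funTS.
  apply: emeasurable_funM => //.
  apply/measurable_EFinP; apply: (measurableT_comp (@measurable_expR R)).
  by apply: measurable_funN; exact: measurable_funM.
move=> s _; rewrite patchE mem_setE in_itv/= andbT; have [s0|s0] := leP s 0%R.
  rewrite /convolution integral0_eq//; last by move=> y _; rewrite /= gamma_density_neg// mul0e.
  by case: ifP => // _; rewrite mule_ge0 ?lee_fin ?expR_ge0.
rewrite (ltW s0); have [A [A0 AE dA]] := gamma_densityP s0.
have -> : (expR (- (ln 2 * s)))%:E =
    A^-1%:E * \int[mu]_y (expR (- y) * gamma_kernel s y)%:E.
  by rewrite gamma_kernel_half// AE -!EFinM mulrCA mulVf ?mulr1// gt_eqF.
have [mk k0] := kernel_gamma_kernel s.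
have mexk : measurable_fun setT (fun y : R => (expR (- y) * gamma_kernel s y)%:E).
  apply/measurable_EFinP; apply: measurable_funM; last exact: measurable_gamma_kernel.
  by apply: (measurableT_comp (@measurable_expR R)); exact: measurable_funN.
have exk0 y : 0 <= (expR (- y) * gamma_kernel s y)%:E.
  by rewrite lee_fin mulr_ge0 ?expR_ge0 ?gamma_kernel_ge0.
have A'0 : (0 <= A^-1)%R by rewrite invr_ge0 ltW.
rewrite -!ge0_integralZl// ?lee_fin ?expR_ge0//; last 2 first.
- by apply: emeasurable_funM.
- by move=> y _; apply: mule_ge0; [rewrite lee_fin|exact: exk0].
have kd := kernel_gamma_density s.
apply: ge0_le_integral => //.
- by move=> y _; apply: mule_ge0; [exact: kd.2|exact: kH.2].
- apply: emeasurable_funM; first exact: kd.1.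
  by apply: (measurableT_comp kH.1); exact: measurable_funB.
- by apply: emeasurable_funM => //; exact: emeasurable_funM.
- move=> y _; rewrite /= dA /heaviside subr_gt0; case: ltP => yT; last first.
    rewrite mule0; apply: mule_ge0; first by rewrite lee_fin expR_ge0.
    by apply: mule_ge0; [rewrite lee_fin|exact: exk0].
  rewrite mule1 -!EFinM lee_fin mulrC [leRHS]mulrCA ler_wpM2l// mulrA -expRD.
  by rewrite ler_peMl ?gamma_kernel_ge0// -expR0 ler_expR subr_ge0 ltW.
Qed.

End TailsOfGammaDensities.

(** * The limit of vanishing shape *)

Section PotentialLevyTail.
Context {R : realType}.
Notation mu := (@lebesgue_measure R).
Implicit Types (f g : R -> \bar R) (s r h t x y T : R).
Local Open Scope ereal_scope.

Let potential_upper h T : (0 < h)%R ->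
  convolution potential (tail (EFin \o gamma_density h)) T <= h%:E.
Proof.
move=> h0; apply: (@potential_tail_upper _ (@gamma_density R)) => //.
- exact: measurable_egamma_density2.
- exact: gamma_density_ge0.
- exact: gamma_density_neg.
- exact: gamma_density_le0.
- exact: integral_gamma_density.
- exact: convolution_gamma_density.
- exact: potential_locally_finite.
Qed.

Let potential_lower h T : (0 < h)%R -> (h <= 1)%R -> (0 < T)%R ->
  h%:E <= convolution potential (tail (EFin \o gamma_density h)) T +
          (2 * expR `|ln T| * h ^+ 2)%:E.
Proof.
move=> h0 h1 T0; apply: (@potential_tail_lower _ (@gamma_density R)) => //.
- exact: measurable_egamma_density2.
- exact: gamma_density_ge0.
- exact: gamma_density_neg.
- exact: gamma_density_le0.
- exact: integral_gamma_density.
- exact: convolution_gamma_density.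
- exact: potential_locally_finite.
- by move=> s s0 sh; apply: tail_gamma_density_le => //; exact: le_trans sh h1.
Qed.

(* The tail of e^(-y)/y, that is E1 on the positive half-line. *)
Definition levy_tail : R -> \bar R := tail (EFin \o gamma_kernel 0).

Lemma kernel_levy_tail : kernel levy_tail.
Proof. exact: kernel_tail (kernel_gamma_kernel 0). Qed.

Let gamma_kernel_upper h y : (0 <= h)%R -> (h <= 1)%R ->
  (gamma_kernel h y)%:E <= (gamma_kernel 0 y)%:E + h%:E * exp_kernel y.
Proof.
move=> h0 h1; have [y0|y0] := leP y 0%R.
  by rewrite !gamma_kernel_le0// add0e mule_ge0 ?lee_fin// expR_ge0.
rewrite -EFinM -EFinD lee_fin /gamma_kernel y0 mul1r sub0r !expRD -mulrDl.
rewrite ler_wpM2r ?expR_ge0// mulN1r expRN lnK//.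
have -> : (y^-1 + h = (1 + h * y) * y^-1)%R.
  by rewrite mulrDl mul1r mulfK// gt_eqF.
have -> : ((h - 1) * ln y = h * ln y - ln y)%R by rewrite mulrBl mul1r.
rewrite expRD [X in (_ * X <= _)%R]expRN lnK// ler_wpM2r ?invr_ge0 ?(ltW y0)//.
exact: expR_ln_le1D.
Qed.

Let small_le (a b c : R) : (0 <= c)%R ->
  (forall h, (0 < h)%R -> (h <= 1)%R -> (a <= b + h * c)%R) -> (a <= b)%R.
Proof.
move=> c0 H; apply/ler_addgt0Pr => e e0.
pose h := Num.min 1%R (e / (c + 1))%R.
have c1 : (0 < c + 1)%R by rewrite ltr_wpDl.
have h0 : (0 < h)%R by rewrite lt_min ltr01 divr_gt0.
have h1 : (h <= 1)%R by rewrite ge_min lexx.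
apply: (le_trans (H h h0 h1)); rewrite lerD2l.
apply: (@le_trans _ _ (h * (c + 1))%R); first by rewrite ler_wpM2l ?(ltW h0)// lerDl.
by rewrite -ler_pdivlMr// ge_min lexx orbT.
Qed.

(** The tail of [gamma_kernel h] exceeds [levy_tail] by at most h times [heaviside], which becomes h
    L after convolution. Multiplying [potential_lower] by Gamma(h) then allows h to tend to 0. *)
Lemma potential_levy_tail_ge1 T : (0 < T)%R ->
  1 <= convolution potential levy_tail T.
Proof.
move=> T0; have kP := @kernel_potential R.
have kL := kernel_levy_tail; have kH := @kernel_heaviside R.
have Lfin : convolution potential heaviside T \is a fin_num.
  by rewrite ge0_fin_numE ?convolution_ge0// potential_locally_finite.
set L := fine (convolution potential heaviside T).
have L0 : (0 <= L)%R by rewrite fine_ge0// convolution_ge0.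
set C := (2 * expR `|ln T|)%R; have C0 : (0 <= C)%R by rewrite mulr_ge0// expR_ge0.
have key h : (0 < h)%R -> (h <= 1)%R -> exists A : R, [/\ (0 < A)%R,
    (1 <= A * h * (1 + h))%R, (A * h <= 1 + h)%R &
    h%:E <= A^-1%:E * (convolution potential levy_tail T + (h * L)%:E) + (C * h ^+ 2)%:E].
  move=> h0 h1; have [A [A0 Al Au tE]] := tail_gamma_density h0 h1.
  exists A; split => //; apply: (le_trans (potential_lower h0 h1 T0)).
  rewrite leeD2r//.
  have A'0 : (0 <= A^-1)%R by rewrite invr_ge0 ltW.
  have kt : kernel (tail (EFin \o gamma_kernel h)).
    exact: kernel_tail (kernel_gamma_kernel h).
  have khH : kernel (fun y => h%:E * heaviside y) by apply: kernelZ => //; exact: ltW.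
  have -> : tail (EFin \o gamma_density h) =
      fun x => A^-1%:E * tail (EFin \o gamma_kernel h) x by apply/funext.
  rewrite convolutionZr// lee_wpmul2l ?lee_fin//.
  have -> : (h * L)%:E = convolution potential (fun y => h%:E * heaviside y) T.
    by rewrite convolutionZr ?(ltW h0)// EFinM fineK.
  rewrite -convolutionDr//; apply: le_convolutionr => //; first exact: kernelD.
  move=> y; apply: (@le_trans _ _ (tail ((EFin \o gamma_kernel 0) \+
      (fun y => h%:E * exp_kernel y)) y)).
    apply: le_tail; first exact: kernel_gamma_kernel.
      apply: kernelD; first exact: kernel_gamma_kernel.
      by apply: kernelZ; [exact: ltW|exact: kernel_exp_kernel].
    by move=> _ z _; exact: gamma_kernel_upper (ltW h0) h1.
  rewrite tailD; [|exact: kernel_gamma_kernel|]; last first.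
    by apply: kernelZ; [exact: ltW|exact: kernel_exp_kernel].
  rewrite leeD2l// tailZ ?(ltW h0)//; last exact: kernel_exp_kernel.
  by rewrite lee_wpmul2l ?lee_fin ?(ltW h0)//; exact: tail_exp_kernel.
case: (convolution potential levy_tail T) (convolution_ge0 T kP kL) key => [w| |//];
  last by move=> *; rewrite leey.
(* The 1 comes from 1 - h <= A h, the [L] from the excess h [heaviside], and 2 C from the error C
   h^2 multiplied by A, with A h <= 2. *)
rewrite !lee_fin => w0 key; apply: (@small_le _ _ (1 + L + 2 * C)).
  by rewrite !addr_ge0// mulr_ge0.
move=> h h0 h1; have [A [A0 Al Au]] := key _ h0 h1.
rewrite -[w%:E + _]EFinD -EFinM -EFinD lee_fin => H.
have {}H : (A * h <= w + h * L + A * h * (C * h))%R.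
  have := ler_wpM2l (ltW A0) H; rewrite mulrDr mulVKf ?gt_eqF//.
  by rewrite expr2; congr (_ <= _)%R; ring.
have h2 : (A * h * (C * h) <= 2 * (C * h))%R.
  apply: ler_wpM2r; first by rewrite mulr_ge0// ltW.
  by apply: (le_trans Au); lra.
have h3 : (1 - h <= A * h)%R.
  have hA : (0 <= A * h)%R by rewrite mulr_ge0// ltW.
  have : (A * h * h <= 2 * h)%R.
    apply: ler_wpM2r; first exact: ltW.
    by apply: (le_trans Au); lra.
  have : ((1 - h) * (1 + h) <= A * h * (1 + h))%R.
    apply: le_trans Al; have : (0 <= h * h)%R by rewrite mulr_ge0// ltW.
    by lra.
  by rewrite ler_pM2r//; lra.
lra.
Qed.

Lemma tail_le0 f x : (x <= 0)%R -> tail f x = 0.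
Proof.
move=> x0; rewrite /tail integral0_eq// => y _.
by rewrite ltNge x0.
Qed.

(** For y >= d, 1/y <= d^(-h) y^(h-1): only at distance d from 0 is [levy_tail] bounded by this
    multiple of the tail of shape h. *)
Let cut (d : R) x := if (d <= x)%R then levy_tail x else 0.

Let kernel_cut d : kernel (cut d).
Proof.
have [ml l0] := kernel_levy_tail; split; last by move=> x; rewrite /cut; case: ifP.
by apply: measurable_fun_ifT => //=; exact: measurable_fun_ler.
Qed.

(** The bound obtained is d^(-h) h Gamma(h) <= e^(h D) (1 + h) <= e^(h (D + 1)), which tends to 1
    with h for fixed d. *)
Let potential_cut_le1 (d : R) T : (0 < d)%R -> (d <= 1)%R ->
  convolution potential (cut d) T <= 1.
Proof.
move=> d0 d1; have kP := @kernel_potential R.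
set D := (- ln d)%R; have D0 : (0 <= D)%R by rewrite oppr_ge0 ln_le0.
have key h : (0 < h)%R -> (h <= 1)%R ->
    convolution potential (cut d) T <= (expR (h * (D + 1)))%:E.
  move=> h0 h1; have [A [A0 _ Au tE]] := tail_gamma_density h0 h1.
  have kt : kernel (tail (EFin \o gamma_density h)).
    exact: kernel_tail (kernel_gamma_density h).
  have eA0 : (0 <= expR (h * D) * A)%R by rewrite mulr_ge0 ?expR_ge0 ?(ltW A0).
  apply: (@le_trans _ _ (convolution potential
      (fun x => (expR (h * D) * A)%:E * tail (EFin \o gamma_density h) x) T)).
    apply: le_convolutionr => //; first exact: kernelZ.
    move=> x; rewrite /cut; case: ifPn => dx; last first.
      by apply: mule_ge0; [rewrite lee_fin|exact: kt.2].
    rewrite tE muleA -EFinM mulfK ?gt_eqF// -tailZ ?expR_ge0//; last first.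
      exact: kernel_gamma_kernel.
    apply: le_tail; first exact: kernel_gamma_kernel.
      by apply: kernelZ; [exact: expR_ge0|exact: kernel_gamma_kernel].
    move=> _ y xy; have dy := le_trans dx xy; have y0 := lt_le_trans d0 dy.
    rewrite -EFinM lee_fin /gamma_kernel y0 -expRD ler_expR.
    have : (ln d <= ln y)%R by rewrite ler_ln.
    rewrite -subr_ge0 => /(mulr_ge0 (ltW h0)); rewrite /D; lra.
  rewrite convolutionZr//; apply: (@le_trans _ _ ((expR (h * D) * A)%:E * h%:E)).
    by apply: lee_wpmul2l; [rewrite lee_fin|exact: potential_upper].
  rewrite -EFinM lee_fin -mulrA mulrDr mulr1 expRD ler_wpM2l ?expR_ge0//.
  exact: le_trans Au (expR_ge1Dx h).
apply/lee_addgt0Pr => e e0; pose h := Num.min 1%R (ln (1 + e) / (D + 1))%R.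
have D1 : (0 < D + 1)%R by rewrite ltr_wpDl.
have h0 : (0 < h)%R by rewrite lt_min ltr01 divr_gt0// ln_gt0// ltrDl.
have h1 : (h <= 1)%R by rewrite ge_min lexx.
apply: (le_trans (key h h0 h1)); rewrite -EFinD lee_fin.
rewrite -[leRHS]lnK; last by rewrite posrE addr_gt0.
by rewrite ler_expR -ler_pdivlMr// ge_min lexx orbT.
Qed.

(** Monotone convergence as d decreases to 0: cutting [levy_tail] at d restricts the convolution
    integral to y <= T - d. *)
Lemma potential_levy_tail_le1 T : convolution potential levy_tail T <= 1.
Proof.
have kP := @kernel_potential R; have kL := kernel_levy_tail.
pose d n : R := (n.+1%:R^-1)%R; have d0 n : (0 < d n)%R by rewrite invr_gt0.
have d1 n : (d n <= 1)%R by rewrite invf_le1// ler1n.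
pose F n : set (measurableTypeR R) := `]-oo, (T - d n)%R]%classic.
pose g y := potential y * levy_tail (T - y)%R.
have mg : measurable_fun setT g.
  apply: emeasurable_funM; first exact: kP.1.
  by apply: (measurableT_comp kL.1); exact: measurable_funB.
have g0 y : 0 <= g y by apply: mule_ge0; [exact: kP.2|exact: kL.2].
have -> : convolution potential levy_tail T = \int[mu]_(y in \bigcup_n F n) g y.
  rewrite [RHS]integral_mkcond; apply: eq_integral => y _.
  rewrite patchE; case: ifPn => // /negP yF; rewrite [X in _ * X]tail_le0 ?mule0//.
  rewrite subr_le0 leNgt; apply/negP => yT; apply: yF; apply/mem_set.
  exists (Num.truncn (T - y)^-1%R) => //; rewrite /F /= in_itv/= lerBrDr addrC -lerBrDr.
  have yT0 : (0 < T - y)%R by rewrite subr_gt0.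
  rewrite invf_ple ?posrE//; exact/ltW/truncnS_gt.
have nd : nondecreasing_seq F.
  move=> m n mn; apply/subsetPset => y; rewrite /F /= !in_itv/= => /le_trans; apply.
  by rewrite lerD2l lerN2 lef_pV2 ?posrE// ler_nat.
have := @ge0_nondecreasing_set_cvg_integral _ (measurableTypeR R) R F g mu nd
  (fun n => measurable_itv _) (fun n => measurable_funTS mg) (fun n y _ => g0 y).
move=> /cvg_lim <- //; apply: lime_le.
  apply: ereal_nondecreasing_is_cvgn.
  exact: (@ge0_nondecreasing_set_nondecreasing_integral _ (measurableTypeR R) R F g mu nd
  (fun n => measurable_itv _) (fun n => measurable_funTS mg) (fun n y _ => g0 y)).
near=> n; apply: le_trans (potential_cut_le1 T (d0 n) (d1 n)).
rewrite integral_mkcond; apply: ge0_le_integral => //.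
- by move=> y _; rewrite patchE; case: ifP.
- apply/(measurable_restrictT _ (measurable_itv _)); exact: measurable_funTS.
- apply: emeasurable_funM; first exact: kP.1.
  by apply: (measurableT_comp (kernel_cut _).1); exact: measurable_funB.
- move=> y _; rewrite patchE mem_setE in_itv/= /cut.
  by rewrite lerBrDr addrC -lerBrDr; case: ifP; rewrite ?mule0.
Unshelve. all: by end_near. Qed.

(* Here potential is the potential density of the Gamma process and levy_tail the
   tail of its Levy measure e^(-y)/y dy. *)
Theorem potential_levy_tail T : (0 < T)%R ->
  convolution potential levy_tail T = 1.
Proof.
move=> T0; apply/eqP; rewrite eq_le potential_levy_tail_le1.
exact: potential_levy_tail_ge1.
Qed.

End PotentialLevyTail.

(** * The Sonine identity for E1 and S with the scale alpha *)

Section RealKernels.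
Context {R : realType}.
Notation mu := (@lebesgue_measure R).
Implicit Types (f g : R -> \bar R) (s r h t x y T alpha : R).
Local Open Scope ereal_scope.

Lemma potential_le0 t : (t <= 0)%R -> potential t = 0.
Proof.
move=> t0; rewrite /potential /superposition integral0_eq// => s _.
by rewrite gamma_density_le0.
Qed.

Lemma levy_tail_fin_num x : levy_tail x \is a fin_num.
Proof.
have [x0|x0] := leP x 0%R; first by rewrite /levy_tail tail_le0.
rewrite ge0_fin_numE; last exact: kernel_levy_tail.2.
have x'0 : (0 <= x^-1)%R by rewrite invr_ge0 ltW.
apply: (@le_lt_trans _ _ (x^-1%:E * heaviside x)); last first.
  by rewrite /heaviside x0 mule1 ltry.
apply: (@le_trans _ _ (x^-1%:E * tail exp_kernel x)); last first.
  by rewrite lee_wpmul2l ?lee_fin//; exact: tail_exp_kernel.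
rewrite -tailZ//; last exact: kernel_exp_kernel.
apply: le_tail; first exact: kernel_gamma_kernel.
  by apply: kernelZ => //; exact: kernel_exp_kernel.
move=> _ y xy; have y0 := lt_le_trans x0 xy.
rewrite -EFinM lee_fin /gamma_kernel y0 mul1r sub0r mulN1r expRD [expR (- ln y)]expRN lnK//.
by rewrite ler_wpM2r ?expR_ge0// lef_pV2.
Qed.

Lemma E1_levy_tail x : (0 < x)%R -> E1 x = fine (levy_tail x).
Proof.
move=> x0; rewrite /E1 /levy_tail /tail /Rintegral integral_mkcond; congr fine.
apply: eq_integral => y _; rewrite patchE mem_setE in_itv/= andbT x0/=.
case: ifPn => // xy; have y0 := lt_le_trans x0 xy.
by congr EFin; rewrite /gamma_kernel y0 sub0r mulN1r expRD [expR (- ln y)]expRN lnK// mulrC.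
Qed.

Let fineMl (c : R) (u : \bar R) : (0 < c)%R -> fine (c%:E * u) = (c * fine u)%R.
Proof.
by move=> c0; case: u => [u| |] //=; rewrite ?gt0_muley ?gt0_muleNy ?lte_fin//= mulr0.
Qed.

Lemma calS_potential t : (0 < t)%R -> calS t = fine (potential t).
Proof.
move=> t0; rewrite /calS /Rintegral -fineMl ?expR_gt0//; congr fine.
rewrite /potential /superposition -ge0_integralZl//.
- rewrite [LHS]integral_mkcond; apply: eq_integral => s _.
  rewrite patchE mem_setE in_itv/= andbT /gamma_density; case: ifPn => // s0.
  rewrite gamma_kernelE// powR_inv1 ?ltW ?Gamma_gt0// -EFinM; congr EFin.
  by move: (Gamma s) => A; rewrite mulrCA mulrA.
- apply: (@eq_measurable_fun _ _ _ _ _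
    (fun s => (t `^ (s - 1) * (Gamma s) `^ (- 1))%:E)) => [s|].
    rewrite inE/= in_itv/= andbT => s0.
    by rewrite powR_inv1// ltW// Gamma_gt0.
  apply: measurable_funTS; apply/measurable_EFinP; apply: measurable_funM.
    by apply: (measurableT_comp (measurable_powRr _)); exact: measurable_funB.
  by apply: (measurableT_comp (measurable_powR _)); exact: measurable_Gamma.
- move=> s /=; rewrite in_itv/= andbT => s0.
  by rewrite lee_fin divr_ge0 ?powR_ge0// ltW// Gamma_gt0.
Qed.

(** Finiteness follows from local integrability. It matters because [calS] is the [fine] of the
    potential, which is 0 wherever the potential is infinite. *)
Let potential_ae_fin : {ae mu, forall y, potential y \is a fin_num}.
Proof.
have kP := @kernel_potential R.
have H (n : nat) : {ae mu, forall y, `]-oo, n%:R[%classic y -> potential y \is a fin_num}.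
  apply: integrable_ae => //.
  apply/integrableP; split; first exact: measurable_funTS kP.1.
  under eq_integral do rewrite gee0_abs ?kP.2//.
  rewrite -convolution_heaviside//; exact: potential_locally_finite.
have : {ae mu, forall y (n : nat), `]-oo, n%:R[%classic y -> potential y \is a fin_num}.
  exact: ae_foralln.
apply: filterS; first exact: (ae_filter_ringOfSetsType mu).
move=> y /(_ (Num.truncn y).+1); apply; rewrite /= in_itv/=; exact: truncnS_gt.
Qed.

(** Extension by 0 turns the integrals over [x, b] into integrals over the line and sets aside the
    value of [E1] at 0. *)
Definition sonine_kernel alpha y : R :=
  if (0 < y)%R then (alpha^-1 * E1 (y / alpha))%R else 0%R.

Definition sonine_cokernel alpha y : R :=
  if (0 < y)%R then calS (y / alpha) else 0%R.

Section Scaled.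
Variable alpha : R.
Hypothesis alpha0 : (0 < alpha)%R.

Let sonine_kernelE : EFin \o sonine_kernel alpha =
  fun y => (alpha^-1)%:E * levy_tail (alpha^-1 * y + 0)%R.
Proof.
apply/funext => y; rewrite /= /sonine_kernel addr0; case: ltP => y0.
  rewrite E1_levy_tail ?divr_gt0// EFinM fineK ?levy_tail_fin_num//.
  by rewrite mulrC.
rewrite [X in _ * X]tail_le0 ?mule0// pmulr_rle0 ?invr_gt0//.
Qed.

Let sonine_cokernelE y : sonine_cokernel alpha y = fine (potential (y / alpha)).
Proof.
rewrite /sonine_cokernel; case: ltP => y0.
  by rewrite calS_potential// divr_gt0.
by rewrite potential_le0// pmulr_lle0 ?invr_gt0.
Qed.

Lemma kernel_sonine_kernel : kernel (EFin \o sonine_kernel alpha).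
Proof.
rewrite sonine_kernelE; apply: kernelZ; first by rewrite invr_ge0 ltW.
have [ml l0] := @kernel_levy_tail R; split; last by move=> y; exact: l0.
exact: measurableT_comp ml (@measurable_affine R _ _).
Qed.

Lemma kernel_sonine_cokernel : kernel (EFin \o sonine_cokernel alpha).
Proof.
have [mP P0] := @kernel_potential R; split => [|y]; last first.
  by rewrite /= sonine_cokernelE lee_fin fine_ge0.
apply/measurable_EFinP.
rewrite (_ : sonine_cokernel alpha = fun y => fine (potential (alpha^-1 * y + 0)%R)).
  have mfine : measurable_fun setT (fine : \bar R -> R) by exact: fine_measurable.
  exact: measurableT_comp mfine (measurableT_comp mP (@measurable_affine R _ _)).
by apply/funext => y; rewrite sonine_cokernelE addr0 mulrC.
Qed.

Let convolution_cokernel g x : kernel g ->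
  convolution (EFin \o sonine_cokernel alpha) g x =
  alpha%:E * \int[mu]_z (potential z * g (x - alpha * z)%R).
Proof.
move=> [mg g0]; have [mS S0] := kernel_sonine_cokernel.
have [mP P0] := @kernel_potential R.
rewrite /convolution (@ge0_integral_affine _ alpha 0); last 3 first.
- by rewrite gt_eqF.
- by apply: emeasurable_funM => //; apply: (measurableT_comp mg); exact: measurable_funB.
- by move=> y; exact: mule_ge0.
rewrite gtr0_norm//; congr (_ * _).
have [N [mN N0 NP]] := potential_ae_fin.
apply: (integral_modif mN N0) => z _ Nz; rewrite /= addr0; congr (_ * _).
rewrite sonine_cokernelE mulrAC mulfV ?gt_eqF// mul1r fineK//.
by apply: contrapT => h; apply/Nz/NP.
Qed.

(** After y = alpha z the Jacobian cancels the factor 1 / alpha of [sonine_kernel], leaving the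
    unscaled identity at x / alpha. For x <= 0 the two factors have disjoint supports. *)
Lemma convolution_sonine x : convolution (EFin \o sonine_cokernel alpha)
  (EFin \o sonine_kernel alpha) x = heaviside x.
Proof.
rewrite convolution_cokernel; last exact: kernel_sonine_kernel.
have [mP P0] := @kernel_potential R; have [ml l0] := @kernel_levy_tail R.
have -> : \int[mu]_z (potential z * (EFin \o sonine_kernel alpha) (x - alpha * z)%R) =
    alpha^-1%:E * convolution potential levy_tail (x / alpha)%R.
  rewrite /convolution -ge0_integralZl//.
  - apply: eq_integral => z _; rewrite sonine_kernelE muleCA; congr (_ * (_ * _)).
    by congr levy_tail; rewrite addr0 mulrBr mulKf ?gt_eqF// mulrC.
  - apply: emeasurable_funM => //; apply: (measurableT_comp ml).
    exact: measurable_funB.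
  - by move=> z _; exact: mule_ge0.
  - by rewrite lee_fin invr_ge0 ltW.
rewrite muleA -EFinM mulfV ?gt_eqF// mul1e /heaviside; case: ltP => x0.
  by rewrite potential_levy_tail// divr_gt0.
rewrite /convolution integral0_eq// => z _.
have [z0|z0] := leP z 0%R; first by rewrite potential_le0// mul0e.
rewrite [X in _ * X]tail_le0 ?mule0// subr_le0 (le_trans _ (ltW z0))//.
by rewrite pmulr_lle0 ?invr_gt0.
Qed.

Lemma cokernel_locally_finite x :
  convolution (EFin \o sonine_cokernel alpha) heaviside x < +oo.
Proof.
rewrite convolution_cokernel; last exact: kernel_heaviside.
rewrite (_ : \int[mu]_z _ = convolution potential heaviside (x / alpha)%R).
  by apply: lte_mul_pinfty; rewrite ?lee_fin ?(ltW alpha0)// potential_locally_finite.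
apply: eq_integral => z _; rewrite /heaviside !subr_gt0; congr (_ * _).
by rewrite ltr_pdivlMr// mulrC.
Qed.

End Scaled.

End RealKernels.

(** * Inversion of the Volterra operator *)

Section SignedConvolution.
Context {R : realType}.
Notation mu := (@lebesgue_measure R).
Local Open Scope ereal_scope.

Lemma measurable_Rintegral2 (F : R * R -> R) : measurable_fun setT F ->
  measurable_fun setT (fun t => (\int[mu]_u F (t, u))%R).
Proof.
move=> mF; have mF' : measurable_fun setT (EFin \o F) by apply/measurable_EFinP.
have -> : (fun t => (\int[mu]_u F (t, u))%R) = fine \o
    ((fun t => \int[mu]_u (EFin \o F)^\+ (t, u)) \-
     (fun t => \int[mu]_u (EFin \o F)^\- (t, u))).
  apply/funext => t; rewrite /Rintegral integralE /=; congr (fine (_ - _)).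
    by apply: eq_integral => u _; rewrite !funeposE.
  by apply: eq_integral => u _; rewrite !funenegE.
apply: measurableT_comp => //; apply: emeasurable_funB.
  apply: (@measurable_fun_fubini_tonelli_F _ _ _ _ _ mu (EFin \o F)^\+) => //.
  exact: measurable_funepos.
apply: (@measurable_fun_fubini_tonelli_F _ _ _ _ _ mu (EFin \o F)^\-) => //.
exact: measurable_funeneg.
Qed.

(* No integrability is needed: when the integral of f is infinite, both sides
   are 0. *)
Lemma Rintegral_scale (D : set (measurableTypeR R)) (c : R) (f : R -> R) :
  measurable D -> measurable_fun D f ->
  (0 <= c)%R -> (\int[mu]_(u in D) (c * f u) = c * \int[mu]_(u in D) f u)%R.
Proof.
move=> mD mf; rewrite le_eqVlt => /predU1P[<-|c0].
  by rewrite mul0r /Rintegral integral0_eq// => u _; rewrite mul0r.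
have mf' : measurable_fun D (EFin \o f) by apply/measurable_EFinP.
have c0' := ltW c0; rewrite /Rintegral.
have -> : \int[mu]_(u in D) (c * f u)%:E = c%:E * \int[mu]_(u in D) (f u)%:E.
  rewrite integralE [X in _ = _ * X]integralE.
  rewrite (ge0_funeposM (EFin \o f) c0') (ge0_funenegM (EFin \o f) c0').
  rewrite !ge0_integralZl//; first last.
  - exact: measurable_funepos.
  - exact: measurable_funeneg.
  have : 0 <= \int[mu]_(u in D) (EFin \o f)^\+ u by exact: integral_ge0.
  have : 0 <= \int[mu]_(u in D) (EFin \o f)^\- u by exact: integral_ge0.
  case: (\int[mu]_(u in D) (EFin \o f)^\- u) => [v| |]// _;
  case: (\int[mu]_(u in D) (EFin \o f)^\+ u) => [w| |]// _;
  rewrite -?EFinD -?EFinM -?EFinB /= ?mulrBr ?gt0_muley ?gt0_muleNy ?lte_fin//.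
case: (\int[mu]_(u in D) (f u)%:E) => [w| |] //=;
  by rewrite ?gt0_muley ?gt0_muleNy ?lte_fin//= mulr0.
Qed.

Lemma convolution_shift (p q : R -> R) (x u : R) :
  kernel (EFin \o p) -> kernel (EFin \o q) ->
  convolution (EFin \o p) (EFin \o q) (u - x) =
  \int[mu]_t ((p (t - x) * q (u - t))%R)%:E.
Proof.
move=> kp kq; rewrite /convolution -(ge0_integral_translate x).
- by apply: eq_integral => t _; rewrite -EFinM opprB addrA subrK.
- apply: emeasurable_funM; first exact: kp.1.
  by apply: (measurableT_comp kq.1); exact: measurable_funB.
- by move=> t; apply: mule_ge0; [exact: kp.2|exact: kq.2].
Qed.

Section Exchange.
Variables p q phi : R -> R.
Hypothesis kp : kernel (EFin \o p).
Hypothesis kq : kernel (EFin \o q).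
Hypothesis iphi : mu.-integrable setT (EFin \o phi).
Variable x : R.
Let c w := convolution (EFin \o p) (EFin \o q) w.
Hypothesis cfin : forall w, c w < +oo.
Hypothesis phic : \int[mu]_u (`|phi u|%:E * c (u - x)%R) < +oo.

Let mphi : measurable_fun setT phi.
Proof. by apply/measurable_EFinP; exact: measurable_int iphi. Qed.

Let mp : measurable_fun setT p.
Proof. by apply/measurable_EFinP; exact: kp.1. Qed.

Let mq : measurable_fun setT q.
Proof. by apply/measurable_EFinP; exact: kq.1. Qed.

Let p0 y : (0 <= p y)%R. Proof. by have := kp.2 y; rewrite lee_fin. Qed.
Let q0 y : (0 <= q y)%R. Proof. by have := kq.2 y; rewrite lee_fin. Qed.

Let cE u : c (u - x)%R = \int[mu]_t ((p (t - x) * q (u - t))%R)%:E.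
Proof. exact: convolution_shift. Qed.

Let F (z : R * R) := (p (z.1 - x) * (q (z.2 - z.1) * phi z.2))%R.

Let mF : measurable_fun setT F.
Proof.
apply: measurable_funM.
  by apply: (measurableT_comp mp); exact: measurable_funB.
apply: measurable_funM.
  by apply: (measurableT_comp mq); exact: measurable_funB.
exact: measurableT_comp mphi _.
Qed.

Let mpq u : measurable_fun setT (fun t : R => ((p (t - x) * q (u - t))%R)%:E).
Proof.
apply/measurable_EFinP; apply: measurable_funM.
  by apply: (measurableT_comp mp); exact: measurable_funB.
by apply: (measurableT_comp mq); exact: measurable_funB.
Qed.

Let iF : (mu \x mu).-integrable setT (EFin \o F).
Proof.
apply/integrable21ltyP; first by apply/measurable_EFinP.
apply: le_lt_trans phic; rewrite le_eqVlt; apply/orP; left; apply/eqP.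
apply: eq_integral => u _; rewrite cE -ge0_integralZl//.
- apply: eq_integral => t _; rewrite -EFinM /F /= !normrM.
  by rewrite (ger0_norm (p0 _)) (ger0_norm (q0 _)) mulrA mulrC.
- exact: mpq.
- by move=> t _; rewrite lee_fin mulr_ge0.
Qed.

Let RintF t : (\int[mu]_u F (t, u) = p (t - x) * \int[mu]_u (q (u - t) * phi u))%R.
Proof.
rewrite -Rintegral_scale//.
apply: measurable_funM => //.
by apply: (measurableT_comp mq); exact: measurable_funB.
Qed.

(** The inner integral is finite for almost every t only; elsewhere the real integral may be a
    default value. *)
Let aeF : {ae mu, forall t, \int[mu]_u (F (t, u))%:E =
  (p (t - x) * \int[mu]_u (q (u - t) * phi u))%R%:E}.
Proof.
have [N [mN N0 NP]] := ae_integrable1 iF; exists N; split => // t tF.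
apply: NP => iFt; apply: tF => /=; rewrite -RintF /Rintegral fineK//.
exact: integrable_fin_num iFt.
Qed.

Lemma exchange_integrable : mu.-integrable setT
  (fun t => (p (t - x) * \int[mu]_u (q (u - t) * phi u))%R%:E).
Proof.
have [N [mN N0 NP]] := aeF; apply/integrableP; split.
  apply/measurable_EFinP; have := measurable_Rintegral2 mF.
  by apply: eq_measurable_fun => t _; exact: RintF.
have /integrableP[_] := integrable_fubini_F iF; apply: le_lt_trans.
rewrite le_eqVlt; apply/orP; left; apply/eqP.
apply: (integral_modif mN N0) => t _ Nt; congr abse.
by apply: contrapT => h; apply/Nt/NP => h'; apply: h; rewrite -h'.
Qed.

(** Fubini's theorem for p(t - x) q(u - t) phi(u), absolutely integrable by [phic]: integrating
    first in t leaves the convolution of p and q at u - x. *)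
Lemma exchange :
  (\int[mu]_t (p (t - x) * \int[mu]_u (q (u - t) * phi u)) =
   \int[mu]_u (phi u * fine (c (u - x))))%R.
Proof.
have [N [mN N0 NP]] := aeF; rewrite /Rintegral; apply: (congr1 fine).
transitivity (\int[mu]_t \int[mu]_u (F (t, u))%:E).
  apply: (integral_modif mN N0) => t _ Nt.
  by apply: contrapT => h; apply/Nt/NP => h'; apply: h; rewrite -h'.
rewrite (Fubini iF); apply: eq_integral => u _ /=.
have c0 : 0 <= c (u - x)%R by rewrite cE integral_ge0// => t _; rewrite lee_fin mulr_ge0.
have ipq : mu.-integrable setT (fun t => ((p (t - x) * q (u - t))%R)%:E).
  apply/integrableP; split; first exact: mpq.
  under eq_integral do rewrite gee0_abs ?lee_fin ?mulr_ge0//.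
  by rewrite -cE.
rewrite EFinM fineK ?ge0_fin_numE// cE muleC -integralZr//.
by apply: eq_integral => t _; rewrite /F /= -EFinM mulrA.
Qed.

End Exchange.
End SignedConvolution.

(** * The inversion formula for an abstract Sonine pair *)

Section VolterraInversion.
Context {R : realType}.
Notation mu := (@lebesgue_measure R).
Variables l k : R -> R.
Hypothesis kl : kernel (EFin \o l).
Hypothesis kk : kernel (EFin \o k).
Hypothesis lneg : forall y, y <= 0 -> l y = 0.
Hypothesis kneg : forall y, y <= 0 -> k y = 0.
Hypothesis lk : forall x, convolution (EFin \o l) (EFin \o k) x = heaviside x.
Hypothesis lfin : forall x, (convolution (EFin \o l) heaviside x < +oo)%E.
Variables a b : R.
Hypothesis ab : a < b.
Variables f g G : R -> R.
Hypothesis intf : mu.-integrable setT (EFin \o f).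
Hypothesis intg : mu.-integrable setT (EFin \o g).
Hypothesis fsupp : forall x, b < x -> f x = 0.
Hypothesis gsupp : forall x, b < x -> g x = 0.
Hypothesis GE : forall t, a <= t -> t <= b -> G b - G t = \int[mu]_(u in `]t, b]) g u.
Hypothesis kf : {ae mu, forall t, t \in `[a, b] -> \int[mu]_u (k (u - t) * f u) = G t}.

(** This step kernel expresses primitives as convolutions, so that [exchange] treats them like the
    operators with kernels [l] and [k]. *)
Let H (y : R) : R := if 0 < y then 1 else 0.

Let HE : heaviside = EFin \o H.
Proof. by apply/funext => y; rewrite /heaviside /H /=; case: ifP. Qed.

Let kH : kernel (EFin \o H).
Proof. by rewrite -HE; exact: kernel_heaviside. Qed.

Let M t := \int[mu]_u (H (u - t) * g u).
Let N v := \int[mu]_u (l (u - v) * g u).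
Let L w := fine (convolution (EFin \o l) (EFin \o H) w).

Let L_fin w : (convolution (EFin \o l) (EFin \o H) w < +oo)%E.
Proof. by rewrite -HE. Qed.

Let LC : convolution (EFin \o H) (EFin \o l) = convolution (EFin \o l) (EFin \o H).
Proof. exact: convolutionC. Qed.

Let lk_fin w : (convolution (EFin \o l) (EFin \o k) w < +oo)%E.
Proof. by rewrite lk /heaviside; case: ifP => // _; rewrite ltry. Qed.

Let finite_norm phi : mu.-integrable setT (EFin \o phi) ->
  (\int[mu]_u `|phi u|%:E < +oo)%E.
Proof. by move=> /integrableP[]. Qed.

Let mnorm (phi : R -> R) : mu.-integrable setT (EFin \o phi) ->
  measurable_fun setT (fun u => `|phi u|%:E).
Proof.
move=> iphi; apply/measurable_EFinP; apply: measurableT_comp => //.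
by apply/measurable_EFinP; exact: measurable_int iphi.
Qed.

Let mconv (p q : R -> R) x : kernel (EFin \o p) -> kernel (EFin \o q) ->
  measurable_fun setT (fun u : R => convolution (EFin \o p) (EFin \o q) (u - x)).
Proof.
move=> kp kq; apply: (measurableT_comp (kernel_convolution kp kq).1).
exact: measurable_funB.
Qed.

Let fc x : (\int[mu]_u (`|f u|%:E * convolution (EFin \o l) (EFin \o k) (u - x)) < +oo)%E.
Proof.
apply: le_lt_trans (finite_norm intf); apply: ge0_le_integral => //.
- by move=> u _; apply: mule_ge0; [rewrite lee_fin|exact: convolution_ge0].
- by apply: emeasurable_funM; [exact: mnorm|exact: mconv].
- exact: mnorm.
- move=> u _; rewrite lk -[leRHS]mule1 lee_wpmul2l ?lee_fin//.
  by rewrite /heaviside; case: ifP.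
Qed.

(** The convolution of [l] with [H] is nondecreasing and [g] vanishes beyond [b], so the value at b
    - x bounds it throughout. *)
Let gc x : (\int[mu]_u (`|g u|%:E * convolution (EFin \o l) (EFin \o H) (u - x)) < +oo)%E.
Proof.
have L0 : (0 <= convolution (EFin \o l) (EFin \o H) (b - x))%E by exact: convolution_ge0.
apply: (@le_lt_trans _ _ (\int[mu]_u (`|g u|%:E *
    convolution (EFin \o l) (EFin \o H) (b - x)))%E); last first.
  rewrite ge0_integralZr//; last exact: mnorm.
  rewrite muleC; apply: lte_mul_pinfty => //; last exact: finite_norm.
  by rewrite ge0_fin_numE.
apply: ge0_le_integral => //.
- by move=> u _; apply: mule_ge0; [rewrite lee_fin|exact: convolution_ge0].
- by apply: emeasurable_funM; [exact: mnorm|exact: mconv].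
- by apply: emeasurable_funM => //; exact: mnorm.
- move=> u _; have [ub|bu] := leP u b; last by rewrite gsupp// normr0 !mul0e.
  apply: lee_wpmul2l; first by rewrite lee_fin.
  apply: ge0_le_integral => //.
  + by move=> y _; apply: mule_ge0; [exact: kl.2|exact: kH.2].
  + apply: emeasurable_funM; first exact: kl.1.
    by apply: (measurableT_comp kH.1); exact: measurable_funB.
  + apply: emeasurable_funM; first exact: kl.1.
    by apply: (measurableT_comp kH.1); exact: measurable_funB.
  + move=> y _; apply: lee_wpmul2l; first exact: kl.2.
    rewrite lee_fin /H; case: ifPn => [h|_]; last by case: ifP.
    by rewrite ifT//; apply: (lt_le_trans h); rewrite !lerB.
Qed.

Let integrable_lH x : mu.-integrable setT (fun t => (l (t - x) * H (b - t))%:E).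
Proof.
have p0 t : (0%:E <= (l (t - x) * H (b - t))%:E)%E.
  rewrite lee_fin mulr_ge0//; last by rewrite /H; case: ifP.
  by have := kl.2 (t - x); rewrite lee_fin.
apply/integrableP; split.
  apply: (@eq_measurable_fun _ _ _ _ _ (fun t : R => (EFin \o l) (t - x)%R * (EFin \o H) (b - t)%R)%E) => //.
  apply: emeasurable_funM.
    by apply: (measurableT_comp kl.1); exact: measurable_funB.
  by apply: (measurableT_comp kH.1); exact: measurable_funB.
under eq_integral do rewrite gee0_abs//.
by rewrite -convolution_shift.
Qed.

Let integrable_Hl x : mu.-integrable setT (fun v => (H (v - x) * l (b - v))%:E).
Proof.
have p0 t : (0%:E <= (H (t - x) * l (b - t))%:E)%E.
  rewrite lee_fin mulr_ge0//; first by rewrite /H; case: ifP.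
  by have := kl.2 (b - t); rewrite lee_fin.
apply/integrableP; split.
  apply: (@eq_measurable_fun _ _ _ _ _ (fun t : R => (EFin \o H) (t - x)%R * (EFin \o l) (b - t)%R)%E) => //.
  apply: emeasurable_funM.
    by apply: (measurableT_comp kH.1); exact: measurable_funB.
  by apply: (measurableT_comp kl.1); exact: measurable_funB.
under eq_integral do rewrite gee0_abs//.
by rewrite -convolution_shift// LC.
Qed.

Let lH_Hl x : \int[mu]_t (l (t - x) * H (b - t)) = \int[mu]_v (H (v - x) * l (b - v)).
Proof. by rewrite /Rintegral -!convolution_shift// LC. Qed.

(** For t <= x the factor [l] vanishes; for x < t < b, G t = G b - M t; for t >= b all terms vanish
    by the supports, [H (b - t)] removing the constant G b. *)
Let inner_identity x t : a <= x -> x <= b ->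
  (t \in `[a, b] -> \int[mu]_u (k (u - t) * f u) = G t) ->
  l (t - x) * \int[mu]_u (k (u - t) * f u) =
  G b * (l (t - x) * H (b - t)) - l (t - x) * M t.
Proof.
move=> ax xb kft; have [tx|xt] := leP t x.
  by rewrite lneg ?subr_le0// !mul0r mulr0 subr0.
have [tb|bt] := ltP t b.
  rewrite kft; last by rewrite in_itv/= !ltW// (le_lt_trans ax).
  rewrite /H subr_gt0 tb mulr1.
  have -> : M t = G b - G t.
    rewrite GE ?(ltW tb) ?(le_trans ax) ?ltW// Rintegral_mkcond.
    apply: eq_Rintegral => u _; rewrite patchE mem_setE in_itv/= /H subr_gt0.
    have [tu|_] := ltP t u; last by rewrite mul0r.
    by rewrite mul1r; case: leP => // bu; rewrite gsupp.
  by rewrite mulrC; ring.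
have h0 (q : R -> R) (phi : R -> R) : (forall y, y <= 0 -> q y = 0) ->
    (forall y, b < y -> phi y = 0) -> \int[mu]_u (q (u - t) * phi u) = 0.
  move=> qn phis; rewrite /Rintegral integral0_eq// => u _; congr EFin.
  have [ut|tu] := leP u t; first by rewrite qn ?mul0r// subr_le0.
  by rewrite phis ?mulr0// (le_lt_trans bt).
rewrite h0// [M t]h0//; last by move=> y y0; rewrite /H ltNge y0.
by rewrite /H subr_gt0 ltNge bt !mulr0 subr0.
Qed.

(** The defect of the formula to be proved, [N] being the operator with kernel [l] applied to
    [g]. *)
Let psi v := f v - G b * l (b - v) + N v.

Let integrable_Hf x : mu.-integrable setT (fun v => (H (v - x) * f v)%:E).
Proof.
have mf : measurable_fun setT f by apply/measurable_EFinP; exact: measurable_int intf.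
have mH : measurable_fun setT H by apply/measurable_EFinP; exact: kH.1.
apply: le_integrable intf => //.
  apply/measurable_EFinP; apply: measurable_funM => //.
  by apply: (measurableT_comp mH); exact: measurable_funB.
move=> v _; rewrite lee_fin /H; case: ifP => _; first by rewrite mul1r.
by rewrite mul0r normr0.
Qed.

Let HlC w : (convolution (EFin \o H) (EFin \o l) w < +oo)%E.
Proof. by rewrite LC. Qed.

Let gcC x : (\int[mu]_u (`|g u|%:E * convolution (EFin \o H) (EFin \o l) (u - x)) < +oo)%E.
Proof. by rewrite LC. Qed.

Let integrable_HN x : mu.-integrable setT (fun v => (H (v - x) * N v)%:E).
Proof. exact (exchange_integrable kH kl intg (gcC x)). Qed.

Let integrable_lM x : mu.-integrable setT (fun t => (l (t - x) * M t)%:E).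
Proof. exact (exchange_integrable kl kH intg (gc x)). Qed.

Let HpsiE x : (fun v => (H (v - x) * psi v)%:E) =
  (fun v => ((H (v - x) * f v)%:E - (G b * (H (v - x) * l (b - v)))%:E) +
            (H (v - x) * N v)%:E)%E.
Proof. by apply/funext => v; rewrite -EFinB -EFinD; congr EFin; rewrite /psi; ring. Qed.

Let integrable_GHl x : mu.-integrable setT (fun v => (G b * (H (v - x) * l (b - v)))%:E).
Proof. by under eq_fun do rewrite EFinM; apply: integrableZl. Qed.

Let integrable_GlH x : mu.-integrable setT (fun t => (G b * (l (t - x) * H (b - t)))%:E).
Proof. by under eq_fun do rewrite EFinM; apply: integrableZl. Qed.

Let integrable_HfGHl x : mu.-integrable setT
  (fun v => (H (v - x) * f v - G b * (H (v - x) * l (b - v)))%:E).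
Proof. by under eq_fun do rewrite EFinB; apply: integrableB. Qed.

Let integrable_psi x : mu.-integrable setT (fun v => (H (v - x) * psi v)%:E).
Proof. by rewrite HpsiE; apply: integrableD => //; apply: integrableB. Qed.

Let integral_psi x : a <= x -> x <= b -> \int[mu]_v (H (v - x) * psi v) = 0.
Proof.
move=> ax xb.
(* Associating [l] with [k] first, the Sonine identity leaves a primitive of [f]. *)
have E1 : \int[mu]_t (l (t - x) * \int[mu]_u (k (u - t) * f u)) =
    \int[mu]_u (H (u - x) * f u).
  rewrite (exchange kl kk intf lk_fin (fc x)); apply: eq_Rintegral => u _.
  by rewrite lk HE /= mulrC.
have E2 : \int[mu]_t (l (t - x) * \int[mu]_u (k (u - t) * f u)) =
    G b * \int[mu]_v (H (v - x) * l (b - v)) - \int[mu]_t (l (t - x) * M t).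
  transitivity (\int[mu]_t (G b * (l (t - x) * H (b - t)) - l (t - x) * M t)).
    apply: ae_eq_RintegralT; have [N0 [mN0 N00 NP]] := kf; exists N0; split => // t ht.
    by apply: NP => kft; apply: ht => _; exact: inner_identity.
  rewrite RintegralB//; [|exact: integrable_GlH|exact: integrable_lM].
  by rewrite RintegralZl// ?lH_Hl//; exact: integrable_lH.
(* Both sides apply [l] and [H] to [g], in opposite orders. *)
have E3 : \int[mu]_t (l (t - x) * M t) = \int[mu]_v (H (v - x) * N v).
  rewrite (exchange kl kH intg L_fin (gc x)) (exchange kH kl intg HlC (gcC x)).
  by rewrite LC.
transitivity (\int[mu]_v (H (v - x) * f v - G b * (H (v - x) * l (b - v)) +
    H (v - x) * N v)).
  by apply: eq_Rintegral => v _; rewrite /psi; ring.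
rewrite RintegralD; [|by []|exact: integrable_HfGHl|exact: integrable_HN].
rewrite RintegralB; [|by []|exact: integrable_Hf|exact: integrable_GHl].
rewrite RintegralZl; [|by []|exact: integrable_Hl].
by rewrite -E1 E2 E3; ring.
Qed.

Theorem volterra_inversion : {ae mu, forall x, x \in `[a, b] ->
  \int[mu]_u (l (u - x) * g u) = - f x + G b * l (b - x)}.
Proof.
(* The zero function is a primitive of [psi] on [a, b], so its derivative 0 equals [psi] almost
   everywhere. The factor [H (v - a)] is there because [psi] need not be integrable to the left of
   a. *)
have int0 x : a <= x -> x <= b -> (fun=> 0) x - (fun=> 0) a =
    \int[mu]_(v in `]a, x]) (H (v - a) * psi v) :> R.
  move=> ax xb; rewrite subrr Rintegral_mkcond.
  transitivity (\int[mu]_v (H (v - a) * psi v - H (v - x) * psi v)).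
    rewrite RintegralB//; [|exact: integrable_psi|exact: integrable_psi].
    by rewrite !integral_psi ?subrr ?(ltW ab).
  apply: eq_Rintegral => v _; rewrite patchE mem_setE in_itv/= /H !subr_gt0.
  have [av|va] /= := ltP a v.
    by have [xv|vx] := ltP x v; rewrite ?subrr// mul0r subr0.
  by rewrite (ltNge x v) (le_trans va ax) /= !mul0r subrr.
have D := derive1_integral_ae (integrable_psi a) int0.
apply: (@filterS2 _ _ (ae_filter_ringOfSetsType mu) _ _ _ _ (ae_neq a) D) => x xa /[swap].
move=> xab /(_ xab); rewrite derive1_cst.
have ax : a < x.
  by move: xab; rewrite in_itv/= => /andP[+ _]; rewrite le_eqVlt eq_sym (negPf xa).
by rewrite /H subr_gt0 ax mul1r /psi -/(N x); lra.
Qed.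

End VolterraInversion.

Section Representatives.
Context {R : realType}.
Notation mu := (@lebesgue_measure R).
Variables (alpha a b : R).
Hypothesis alpha0 : 0 < alpha.

Let restrict_Rintegral (q phi : R -> R) x : a <= x ->
  (forall y, y <= 0 -> q y = 0) ->
  \int[mu]_(t in `[x, b]) (q (t - x) * phi t) =
  \int[mu]_t (q (t - x) * (phi \_ `[a, b]) t).
Proof.
move=> ax q0; rewrite Rintegral_mkcond; apply: eq_Rintegral => t _.
rewrite !patchE -[point]/(0 : R) !mem_setE !in_itv/=.
have [xt|tx] /= := leP x t; last by rewrite q0 ?mul0r// subr_le0 ltW.
by rewrite (le_trans ax xt)/=; case: ifP; rewrite ?mulr0.
Qed.

(** The integrands match except possibly at t = x. Moving alpha across the integral by
    [Rintegral_scale] keeps the equality valid where the integral diverges. *)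
Lemma Jint_sonine_kernel (f : R -> R) x : mu.-integrable `[a, b] (EFin \o f) ->
  a <= x -> Jint alpha b f x =
  \int[mu]_t (sonine_kernel alpha (t - x) * (f \_ `[a, b]) t).
Proof.
move=> intf ax; have kn y : y <= 0 -> sonine_kernel alpha y = 0.
  by move=> y0; rewrite /sonine_kernel ltNge y0.
rewrite -restrict_Rintegral// /Jint.
have mkf : measurable_fun `[x, b] (fun u => sonine_kernel alpha (u - x) * f u).
  have xb_ab : `[x, b] `<=` `[a, b] by apply: subset_itvr; rewrite bnd_simp.
  apply: measurable_funM.
    apply: measurable_funTS.
    have mk : measurable_fun setT (sonine_kernel alpha).
      by apply/measurable_EFinP; exact: (kernel_sonine_kernel alpha0).1.
    by apply: (measurableT_comp mk); exact: measurable_funB.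
  apply: (measurable_funS _ xb_ab) => //.
  by apply/measurable_EFinP; exact: measurable_int intf.
transitivity (alpha^-1 * \int[mu]_(u in `[x, b])
    (alpha * (sonine_kernel alpha (u - x) * f u))).
  congr (_ * _); apply: ae_eq_RintegralT.
  apply: filterS (ae_neq x) => [|t tx]; first exact: (ae_filter_ringOfSetsType mu).
  rewrite /= in_itv/= => /andP[xt _].
  rewrite /sonine_kernel subr_gt0 lt_neqAle eq_sym tx xt/= !mulrA mulfV ?mul1r//.
  by rewrite gt_eqF.
by rewrite Rintegral_scale// ?(ltW alpha0)// mulKf ?gt_eqF.
Qed.

Lemma Sint_sonine_cokernel (g : R -> R) x : a <= x ->
  Sint alpha b g x =
  \int[mu]_t (sonine_cokernel alpha (t - x) * (g \_ `[a, b]) t).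
Proof.
move=> ax; rewrite -restrict_Rintegral//; last first.
  by move=> y y0; rewrite /sonine_cokernel ltNge y0.
apply: ae_eq_RintegralT; apply: filterS (ae_neq x) => [|t tx]; first exact: (ae_filter_ringOfSetsType mu).
rewrite /= in_itv/= => /andP[xt _].
by rewrite /sonine_cokernel subr_gt0 lt_neqAle eq_sym tx xt.
Qed.

End Representatives.

Theorem theorem4p8 (R : realType) (alpha a b : R) (f : R -> R)
  (halpha : 0 < alpha) (hab : a < b)
  (hf : (@lebesgue_measure R).-integrable `[a, b] (EFin \o f))
  (hJ : has_ac_repr a b (Jint alpha b f)) :
  {ae (@lebesgue_measure R), forall x, x \in `[a, b] ->
    Sint alpha b (Dfrac alpha a b f) x =
    - f x + ac_repr a b (Jint alpha b f) b * calS ((b - x) / alpha)}.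
Proof.
set G := ac_repr a b (Jint alpha b f).
have [acG JG] : is_ac_repr a b (Jint alpha b f) G by exact: xgetPex.
have [g0 ig0 gE] := abs_continuous_integral (ltW hab) acG.
have DG : {ae lebesgue_measure, forall x, x \in `[a, b] -> Dfrac alpha a b f x = g0 x}.
  by apply: (derive1_integral_ae ig0) => x ax xb; exact: gE.
set f' := f \_ `[a, b]; set g := g0 \_ `[a, b].
have restr_int (h : R -> R) :
    (@lebesgue_measure R).-integrable `[a, b] (EFin \o h) ->
    (@lebesgue_measure R).-integrable setT (EFin \o (h \_ `[a, b])).
  by move=> ih; rewrite -restrict_EFin; apply/integrable_restrict => //; rewrite setTI.
have supp (h : R -> R) x : b < x -> (h \_ `[a, b]) x = 0.
  by move=> bx; rewrite patchE mem_setE in_itv/= (leNgt x) bx andbF.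
have if' := restr_int _ hf.
have ig : (@lebesgue_measure R).-integrable setT (EFin \o g).
  by apply: restr_int; exact: integrableS ig0.
have GE t : a <= t -> t <= b -> G b - G t = \int[lebesgue_measure]_(u in `]t, b]) g u.
  move=> at_ tb; rewrite gE//; apply: eq_Rintegral => u; rewrite inE/= in_itv/= => /andP[tu ub].
  by rewrite /g patchE mem_setE in_itv/= ub (ltW (le_lt_trans at_ tu)).
have kf : {ae lebesgue_measure, forall t, t \in `[a, b] ->
    \int[lebesgue_measure]_u (sonine_kernel alpha (u - t) * f' u) = G t}.
  apply: filterS JG => [|t JGt tab]; first exact: (ae_filter_ringOfSetsType lebesgue_measure).
  by rewrite -Jint_sonine_kernel ?JGt//; move: tab; rewrite in_itv/= => /andP[].
have ln y : y <= 0 -> sonine_cokernel alpha y = 0.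
  by move=> y0; rewrite /sonine_cokernel ltNge y0.
have kn y : y <= 0 -> sonine_kernel alpha y = 0.
  by move=> y0; rewrite /sonine_kernel ltNge y0.
have V := volterra_inversion (kernel_sonine_cokernel halpha) (kernel_sonine_kernel halpha)
  ln kn (convolution_sonine halpha) (cokernel_locally_finite halpha) hab if' ig
  (supp f) (supp g0) GE kf.
(* The point x = b is discarded: there [sonine_cokernel] is 0 by convention, while the statement
   involves [calS] at 0. *)
apply: (@filterS2 _ _ (ae_filter_ringOfSetsType lebesgue_measure) _ _ _ _ (ae_neq b) V).
move=> x xb Vx xab; have := Vx xab; rewrite [(f \_ _) x]patchE mem_setE xab.
move: xab; rewrite in_itv/= => /andP[ax xb'].
have -> : sonine_cokernel alpha (b - x) = calS ((b - x) / alpha).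
  by rewrite /sonine_cokernel subr_gt0 lt_neqAle xb xb'.
move=> <-; rewrite -(Sint_sonine_cokernel alpha b g0 ax).
(* The derivative and its density [g0] differ only on a null set, which the integral ignores. *)
apply: ae_eq_RintegralT; apply: filterS DG => [|t Dt]; first exact: (ae_filter_ringOfSetsType lebesgue_measure).
rewrite /= in_itv/= => /andP[xt tb]; rewrite Dt// in_itv/= tb andbT.
exact: le_trans xt.
Qed.
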